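(* Suppose that $\{Z_i\}_{1\le i\le T}$ is an absolutely regular sequence of $\mathrm{A}$-valued random variables with coefficients satisfying $\beta(l)=O(l^{-1-r})$ for some $r>0$, and that $\{Z_i\}_{1\le i\le M}$ and $\{Z_i\}_{M+1\le i\le T}$ are both ergodic stationary, with marginal probability measures $\mu_1$ and $\mu_2$ respectively. If $M,T\to\infty$ and $M/T\to\alpha_1$ for some $\alpha_1\in[0,1]$, then $$\frac{V(M,T)}{T}\longrightarrow V(\alpha_1;\mu_1,\mu_2)\quad\text{almost surely},$$ where $V(\alpha_1;\mu_1,\mu_2)=\alpha_1(1-\alpha_1)D_{\alpha_1}(\mu_1,\mu_2)$.
   Context: $(\mathrm{A},\|\cdot\|)$ is a separable Banach space, $\rho(u,v)=\|u-v\|$, $\bar B(u,r)=\{x:\rho(x,u)\le r\}$. For Borel probability measures $\mu,\nu$ on $\mathrm{A}$ and $\alpha\in[0,1]$, $$D_\alpha(\mu,\nu)=\iint_{\mathrm{A}\times\mathrm{A}}\big[\mu(\bar B(u,\rho(u,v)))-\nu(\bar B(u,\rho(u,v)))\big]^2\,\omega_\alpha(du)\,\omega_\alpha(dv),\qquad \omega_\alpha=\alpha\mu+(1-\alpha)\nu.$$ Sample statistic: let $c(x,y;z)=I(z\in\bar B(x,\rho(x,y)))$, $N=T-M$, $C^1_{ij}=\frac1M\sum_{u=1}^M c(Z_i,Z_j;Z_u)$, $C^2_{ij}=\frac1N\sum_{v=M+1}^T c(Z_i,Z_j;Z_v)$, $$D_{M,N}=\frac1{T^2}\sum_{i,j=1}^T(C^1_{ij}-C^2_{ij})^2,\qquad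 V(M,T)=\frac{MN}{T}D_{M,N}.$$ Absolute regularity: for sub-$\sigma$-fields $\mathscr A,\mathscr B$, $\beta(\mathscr A,\mathscr B)=\sup\sum_{i=1}^m\sum_{j=1}^n|P(A_i\cap B_j)-P(A_i)P(B_j)|$, the supremum over all finite partitions $A_1,\dots,A_m\in\mathscr A$ and $B_1,\dots,B_n\in\mathscr B$ of the sample space and all $m,n\ge1$. A sequence $\{Z_i\}$ is absolutely regular if $\beta(l)=\sup_n\beta(\mathscr F_0^n,\mathscr F_{n+l}^\infty)\to0$ as $l\to\infty$, where $\mathscr F_i^j$ is the $\sigma$-field generated by $Z_i,\dots,Z_j$. Ergodic stationary sequence: a sequence of the form $Z_i=f(G^i)$ with $G$ an ergodic probability-preserving transformation of a probability space and $f$ measurable. *)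

(* Defs.v *)
From HB Require Import structures.
From mathcomp Require Import all_boot all_order all_algebra.
From mathcomp Require Import all_classical all_reals all_analysis.
Set Implicit Arguments.
Unset Strict Implicit.
Unset Printing Implicit Defensive.
Import Order.TTheory GRing.Theory Num.Theory.
Import numFieldNormedType.Exports.
Local Open Scope classical_set_scope.
Local Open Scope ring_scope.

Definition borel (T : ptopologicalType) := g_sigma_algebraType (@open T).

Definition separable (T : topologicalType) : Prop :=
  exists2 D : set T, countable D & dense D.

(* The library's [closed_ball x r] is the closure of the open ball, hence empty
   for r = 0, whereas here the ball of radius 0 must be {x}; so the norm-based
   [closed_ball_] is used. *)
Definition ballto (R : realType) (A : normedModType R) (u v : A) : set A :=
  closed_ball_ Num.norm u `|u - v|.

Section BallDivergence.
Context {R : realType} {A : normedModType R}.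

Definition mixture (a : {i01 R})
    (mu nu : {measure set (borel A) -> \bar R}) :=
  measure_add (mscale (a%:num)%:nng mu) (mscale (1 - a%:num)%:nng nu).

Definition ball_divergence (a : {i01 R}) (mu nu : probability (borel A) R) : R :=
  \int[mixture a mu nu]_u \int[mixture a mu nu]_v
    (fine (mu (ballto u v)) - fine (nu (ballto u v))) ^+ 2.

Definition V_limit (a : {i01 R}) (mu nu : probability (borel A) R) : R :=
  a%:num * (1 - a%:num) * ball_divergence a mu nu.

Definition cball (x y z : A) : R := \1_(ballto x y) z.

(* Observations are z 1, ..., z T; the value z 0 is never used. *)
Definition C1 (z : nat -> A) (M : nat) (i j : nat) : R :=
  M%:R^-1 * \sum_(1 <= u < M.+1) cball (z i) (z j) (z u).

Definition C2 (z : nat -> A) (M T : nat) (i j : nat) : R :=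
  (T - M)%:R^-1 * \sum_(M.+1 <= v < T.+1) cball (z i) (z j) (z v).

Definition D_stat (z : nat -> A) (M T : nat) : R :=
  (T%:R ^+ 2)^-1 *
  \sum_(1 <= i < T.+1) \sum_(1 <= j < T.+1) (C1 z M i j - C2 z M T i j) ^+ 2.

Definition V_stat (z : nat -> A) (M T : nat) : R :=
  M%:R * (T - M)%:R / T%:R * D_stat z M T.

End BallDivergence.

Section AbsoluteRegularity.
Context {d d' : measure_display} {R : realType}.
Context {W : measurableType d} {E : measurableType d'}.
Variable P : probability W R.

(* [partition] asks for nonempty blocks; empty ones would contribute 0. *)
Definition beta_dep (FA FB : set (set W)) : \bar R :=
  ereal_sup [set x | exists m n (U : 'I_m -> set W) (V : 'I_n -> set W),
    [/\ partition setT U setT, partition setT V setT,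
        (forall i, FA (U i)), (forall j, FB (V j)) &
        x = (\sum_(i < m) \sum_(j < n)
               `|P (U i `&` V j) - P (U i) * P (V j)|)%E]].

Definition sigma_field_of (X : nat -> W -> E) (J : set nat) : set (set W) :=
  <<s \bigcup_(k in J) preimage_set_system setT (X k) measurable >>.

(* Coefficients of the finite sequence X 1, ..., X T. *)
Definition beta_seq (X : nat -> W -> E) (T l : nat) : \bar R :=
  ereal_sup [set beta_dep
    (sigma_field_of X [set k | (1 <= k <= n)%N])
    (sigma_field_of X [set k | (1 <= k)%N /\ (n + l <= k <= T)%N])
    | n in [set: nat]].

(* As M moves with T, so does the law of the sample: the observations form a
   triangular array whose row T is X T 1, ..., X T T. A single row is finite, so
   its own coefficients vanish for l >= T; the coefficients that govern T -> oo
   are those uniform over the rows. *)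
Definition beta_array (X : nat -> nat -> W -> E) (l : nat) : \bar R :=
  ereal_sup [set beta_seq (X T) T l | T in [set: nat]].

Definition absolutely_regular (X : nat -> nat -> W -> E) : Prop :=
  beta_array X l @[l --> \oo] --> 0%E.

Definition ergodic_transformation (G : W -> W) : Prop :=
  [/\ measurable_fun setT G,
      forall B, measurable B -> P (G @^-1` B) = P B &
      forall B, measurable B -> G @^-1` B = B -> P B = 0%E \/ P B = 1%E].

End AbsoluteRegularity.

(* The variables X k, k in J, are jointly distributed as the f (G^k) with G an
   ergodic transformation of some probability space: being ergodic stationary
   is a property of the law of the family, and the space carrying G need not
   be the one on which X is defined. *)
Definition ergodic_stationary {d d' : measure_display} {R : realType}
    {W : measurableType d} {E : measurableType d'} (P : probability W R)
    (J : set nat) (X : nat -> W -> E) : Prop :=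
  exists (e : measure_display) (W' : measurableType e) (Q : probability W' R)
         (G : W' -> W') (f : W' -> E),
    [/\ ergodic_transformation Q G, measurable_fun setT f &
        forall B : nat -> set E, (forall k, measurable (B k)) ->
          P (\bigcap_(k in J) (X k @^-1` B k)) =
          Q (\bigcap_(k in J) ((fun w => f (iter k G w)) @^-1` B k))].

(* Main.v *)
(* The rows of the array are unrelated to one another, so almost sure convergence has to come
   from Borel-Cantelli: each deviation must have probability summable in T. Up to beta(q),
   absolute regularity makes the joint law of a past and a future block separated by q a product.
   Hence indices in arithmetic progression with gap q carry almost independent observations: for
   centered functions bounded by 1 and k terms, peeling off the last one at a time gives P(S > c)
   <= k beta(q) + exp(-lambda c) (1 + 2 lambda^2)^k. With q of order T^(1-s), k of order T^s and
   s = r / (2 (2 + r)) this is O(T^(-1-r/2)). Averaging over residues mod q extends it to full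
   sums.

   With p = M/T, V/T is p (1 - p) times the mean over (i, j) of (C1_ij - C2_ij)^2. Replacing C1,
   C2 by the masses of the ball, then the mean over j and finally the mean over i by integrals
   costs each time an average over (i, j) of sums over u of phi_u(Z_i, Z_j, Z_u), with phi_u
   centered in its last argument. For i <= j, Z_i and Z_j are decoupled from the Z_u on the
   intervals to the left of i, between i and j and to the right of j, hence become constants; the
   O(q) indices close to i or j are negligible. *)
Require Import Defs.
From HB Require Import structures.
From mathcomp Require Import all_boot all_order all_algebra.
From mathcomp Require Import all_classical all_reals all_analysis.
From mathcomp Require Import measurable_realfun zify lra ring.
Set Implicit Arguments.
Unset Strict Implicit.
Unset Printing Implicit Defensive.
Import Order.TTheory GRing.Theory Num.Theory.
Import numFieldNormedType.Exports.
Local Open Scope classical_set_scope.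
Local Open Scope ring_scope.

(** * Decoupling past and future *)

Lemma measure_fibers d (T : measurableType d) (R : realType)
    (m : {measure set T -> \bar R}) (K : finType) (p : T -> K) (D : set T) :
  (forall k, measurable (p @^-1` [set k])) -> measurable D ->
  m D = (\sum_(k : K) m (D `&` p @^-1` [set k]))%E.
Proof.
move=> mp mD.
rewrite [LHS](_ : _ = m (\bigcup_(k in [set` index_enum K]) (D `&` p @^-1` [set k]))).
  rewrite measure_fin_bigcup//.
  - by rewrite -fsbig_seq// index_enum_uniq.
  - by move=> i j _ _ [x [[_ /= <-] [_ /= <-]]].
  - by move=> i _; exact: measurableI.
congr (m _); apply/seteqP; split=> [x Dx|x [k _ []]//].
by exists (p x) => //=; rewrite mem_index_enum.
Qed.

Section decoupling.
Context {d : measure_display} {W : measurableType d} {R : realType}.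
Variable P : probability W R.

(* Maps into finite types may have empty fibres, which [partition] forbids. *)
Lemma beta_dep_fibers (FA FB : set (set W)) (K L : finType) (p : W -> K) (q : W -> L) :
  (forall k, FA (p @^-1` [set k])) -> (forall l, FB (q @^-1` [set l])) ->
  (\sum_(k : K) \sum_(l : L) `|P (p @^-1` [set k] `&` q @^-1` [set l]) -
     P (p @^-1` [set k]) * P (q @^-1` [set l])| <= beta_dep P FA FB)%E.
Proof.
move=> pA qB.
pose KN := [pred k | `[< p @^-1` [set k] !=set0 >]].
pose LN := [pred l | `[< q @^-1` [set l] !=set0 >]].
have pK w : p w \in KN by apply/asboolP; exists w.
have qL w : q w \in LN by apply/asboolP; exists w.
have part (I : finType) (N : pred I) (h : W -> I) : (forall w, h w \in N) ->
    (forall i, i \in N -> h @^-1` [set i] !=set0) ->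
    partition setT (fun i : 'I_#|N| => h @^-1` [set enum_val i]) setT.
  move=> hN N0; split.
  - apply/seteqP; split=> // w _; exists (enum_rank_in (hN w) (h w)) => //=.
    by rewrite enum_rankK_in.
  - move=> i j _ _ [w [/= -> /enum_val_inj]]; exact.
  - by move=> i _; apply: N0; exact: enum_valP.
apply: ereal_sup_ubound => /=.
exists #|KN|, #|LN|, (fun i => p @^-1` [set enum_val i]),
  (fun j => q @^-1` [set enum_val j]); split => //.
- by apply: part => // i /asboolP.
- by apply: part => // i /asboolP.
rewrite (bigID (mem KN)) /= [X in (_ + X)%E]big1 ?adde0; last first.
  move=> k /asboolP/set0P/negP; rewrite negbK => /eqP ->.
  by rewrite big1// => l _; rewrite set0I measure0 mul0e sube0 abse0.
rewrite big_enum_val; apply: eq_bigr => i _.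
rewrite (bigID (mem LN)) /= [X in (_ + X)%E]big1 ?adde0; last first.
  move=> l /asboolP/set0P/negP; rewrite negbK => /eqP ->.
  by rewrite setI0 measure0 mule0 sube0 abse0.
by rewrite big_enum_val.
Qed.


Variables (d1 d2 : measure_display) (E1 : measurableType d1) (E2 : measurableType d2).

(** Finite unions of rectangles, encoded by finite labellings of the two factors: two such sets are
    put on a common grid by pairing labels, and the fibres of a labelling form the kind of partition
    over which beta takes its supremum. *)
Definition rectangle_union (E : set (E1 * E2)) : Prop :=
  exists (K L : finType) (p : E1 -> K) (q : E2 -> L) (S : K -> L -> bool),
    [/\ forall k, measurable (p @^-1` [set k]), forall l, measurable (q @^-1` [set l]) &
        E = [set z | S (p z.1) (q z.2)]].

Lemma setring_rectangle_union : setring rectangle_union.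
Proof.
have pair d0 (E : measurableType d0) (K L : finType) (p : E -> K) (q : E -> L) :
    (forall k, measurable (p @^-1` [set k])) -> (forall l, measurable (q @^-1` [set l])) ->
    forall kl, measurable ((fun x => (p x, q x)) @^-1` [set kl]).
  move=> mp mq [k l].
  rewrite (_ : _ @^-1` _ = p @^-1` [set k] `&` q @^-1` [set l]); first exact: measurableI.
  by apply/seteqP; split=> x /= [-> ->].
split.
- exists unit, unit, (fun=> tt), (fun=> tt), (fun _ _ => false); split=> //.
  + by move=> []; rewrite preimage_cst mem_set//; exact: measurableT.
  + by move=> []; rewrite preimage_cst mem_set//; exact: measurableT.
  + by apply/seteqP; split.
- move=> _ _ [K [L [p [q [S [mp mq ->]]]]]] [K' [L' [p' [q' [S' [mp' mq' ->]]]]]].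
  exists (K * K')%type, (L * L')%type, (fun x => (p x, p' x)), (fun x => (q x, q' x)),
    (fun k l => S k.1 l.1 || S' k.2 l.2); split; [exact: pair|exact: pair|].
  by apply/seteqP; split => x /= /orP.
- move=> _ _ [K [L [p [q [S [mp mq ->]]]]]] [K' [L' [p' [q' [S' [mp' mq' ->]]]]]].
  exists (K * K')%type, (L * L')%type, (fun x => (p x, p' x)), (fun x => (q x, q' x)),
    (fun k l => S k.1 l.1 && ~~ S' k.2 l.2); split; [exact: pair|exact: pair|].
  apply/seteqP; split => x /=; first by move=> [-> /negP ->].
  by move=> /andP[? /negP].
Qed.

(** The sigma-ring form is what the monotone class theorem for set rings yields. The whole space is
    itself a rectangle, and a rectangle is labelled by the indicators of its sides. *)
Lemma measurable_rectangle_union (E : set (E1 * E2)) :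
  measurable E -> <<sr rectangle_union>> E.
Proof.
rewrite measurable_prod_measurableType; apply: smallest_sub.
- have [S0 SD SU] := smallest_sigma_ring rectangle_union.
  split => // A SA; apply: SD => //; apply: sub_g_sigma_ring.
  exists unit, unit, (fun=> tt), (fun=> tt), (fun _ _ => true); split=> //.
  + by move=> []; rewrite preimage_cst mem_set//; exact: measurableT.
  + by move=> []; rewrite preimage_cst mem_set//; exact: measurableT.
  + by apply/seteqP; split.
- move=> _ [A mA [B mB <-]]; apply: sub_g_sigma_ring.
  have mb d0 (E0 : measurableType d0) (C : set E0) : measurable C ->
      forall k, measurable ((fun x => x \in C) @^-1` [set k]).
    move=> mC k; rewrite (_ : _ @^-1` _ = if k then C else ~` C).
      by case: k => //; exact: measurableC.
    apply/seteqP; split=> x; case: k => /=; rewrite /setC /=.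
    - exact: set_mem.
    - by move=> + Cx; rewrite mem_set.
    - exact: mem_set.
    - exact: memNset.
  exists bool, bool, (fun x => x \in A), (fun x => x \in B), andb; split.
  + exact: mb.
  + exact: mb.
  + by apply/seteqP; split=> x /=; [move=> [? ?]; apply/andP; rewrite !inE|
      move/andP; rewrite !inE].
Qed.

(** Continuity of both measures from below and from above; finiteness of the total masses serves the
    latter. *)
Lemma monotone_le_measure (m1 m2 : {measure set (E1 * E2)%type -> \bar R}) (b : \bar R) :
  (m1 setT < +oo)%E -> (m2 setT < +oo)%E -> b \is a fin_num ->
  monotone [set E | measurable E /\ (m1 E <= m2 E + b)%E].
Proof.
move=> m1fin m2fin bfin; split=> F monoF mF.
- have mUF : measurable (\bigcup_n F n) by apply: bigcup_measurable => n _; exact: (mF n).1.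
  split => //.
  have c1 : m1 (F n) @[n --> \oo] --> m1 (\bigcup_n F n).
    by apply: nondecreasing_cvg_mu => // n; exact: (mF n).1.
  have c2 : (m2 (F n) + b)%E @[n --> \oo] --> (m2 (\bigcup_n F n) + b)%E.
    apply: cvgeD; [by rewrite fin_num_adde_defl| |exact: cvg_cst].
    by apply: nondecreasing_cvg_mu => // n; exact: (mF n).1.
  by apply: (lee_cvg_to c1 c2); apply: nearW => n; exact: (mF n).2.
- have mUF : measurable (\bigcap_n F n) by apply: bigcap_measurable => // n _; exact: (mF n).1.
  have fin (m : {measure set (E1 * E2)%type -> \bar R}) : (m setT < +oo -> m (F 0%N) < +oo)%E.
    by apply: le_lt_trans; apply: le_measure; rewrite ?inE//; exact: (mF 0%N).1.
  split => //.
  have c1 : m1 (F n) @[n --> \oo] --> m1 (\bigcap_n F n).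
    by apply: nonincreasing_cvg_mu => //; [exact: fin|move=> n; exact: (mF n).1].
  have c2 : (m2 (F n) + b)%E @[n --> \oo] --> (m2 (\bigcap_n F n) + b)%E.
    apply: cvgeD; [by rewrite fin_num_adde_defl| |exact: cvg_cst].
    by apply: nonincreasing_cvg_mu => //; [exact: fin|move=> n; exact: (mF n).1].
  by apply: (lee_cvg_to c1 c2); apply: nearW => n; exact: (mF n).2.
Qed.

Lemma measure_rectangle_union (m : {measure set (E1 * E2)%type -> \bar R}) (K L : finType)
    (p : E1 -> K) (q : E2 -> L) (S : K -> L -> bool) :
  (forall k, measurable (p @^-1` [set k])) -> (forall l, measurable (q @^-1` [set l])) ->
  measurable [set z | S (p z.1) (q z.2)] ->
  m [set z | S (p z.1) (q z.2)] =
  (\sum_(k : K) \sum_(l : L | S k l) m ((p @^-1` [set k]) `*` (q @^-1` [set l])))%E.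
Proof.
move=> mp mq mS.
rewrite (@measure_fibers _ _ _ m (K * L)%type (fun z => (p z.1, q z.2)))//; last first.
  move=> [k l]; rewrite (_ : _ @^-1` _ = (p @^-1` [set k]) `*` (q @^-1` [set l])).
    exact: measurableX.
  by apply/seteqP; split=> x /= [-> ->].
transitivity (\sum_(k : K) \sum_(l : L) m ([set z | S (p z.1) (q z.2)] `&`
    (fun z => (p z.1, q z.2)) @^-1` [set (k, l)]))%E.
  by rewrite pair_bigA; apply: eq_bigr => -[k l] _.
apply: eq_bigr => k _; rewrite [RHS]big_mkcond/=; apply: eq_bigr => l _.
case: ifPn => Skl.
  by congr (m _); apply/seteqP; split=> x /= [] => [_ [-> ->]//|-> ->].
rewrite (_ : _ `&` _ = set0) ?measure0//; apply/seteqP; split=> // x /= [+ [pk ql]].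
by rewrite pk ql (negPf Skl).
Qed.

Variables (X : {mfun W >-> E1}) (Y : {mfun W >-> E2}).

(* The value of beta bounds, up to a sign, the gap between the joint law of (X, Y) and the product
   of the marginals on a finite union of rectangles; monotone classes pass to the product
   sigma-algebra. *)
Lemma decouple (FA FB : set (set W)) (b : R) (E : set (E1 * E2)) :
  (forall B, measurable B -> FA (X @^-1` B)) -> (forall B, measurable B -> FB (Y @^-1` B)) ->
  (beta_dep P FA FB <= b%:E)%E -> measurable E ->
  (P [set w | E (X w, Y w)] <= \int[P]_w P [set w' | E (X w, Y w')] + b%:E)%E.
Proof.
move=> XA YB betab mE.
pose XY : {mfun W >-> (E1 * E2)%type} :=
  mfun_Sub (mem_set (measurable_fun_pair
    (@measurable_funPT _ _ _ _ X) (@measurable_funPT _ _ _ _ Y))).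
pose m1 := distribution P XY.
pose m2 := (distribution P X \x distribution P Y)%E.
suff: (m1 E <= m2 E + b%:E)%E.
  rewrite {1}/m1 /distribution /pushforward /= => /le_trans; apply; rewrite leeD2r//.
  rewrite /m2 /product_measure1 ge0_integral_distribution//; last first.
    exact: measurable_fun_xsection.
  rewrite le_eqVlt; apply/orP; left; apply/eqP; apply: eq_integral => w _ /=.
  by congr (P _); apply/seteqP; split=> w' /=; rewrite /xsection /= inE.
suff /(_ _ (measurable_rectangle_union mE))[//] : <<sr rectangle_union>> `<=`
  [set E | measurable E /\ (m1 E <= m2 E + b%:E)%E].
apply: monotone_setring_sub_g_sigma_ring.
- apply: monotone_le_measure => //.
    by apply: (le_lt_trans (probability_le1 (distribution P XY) measurableT)); rewrite ltry.
  rewrite -[X in (X < _)%E]/(m2 setT) /m2 -setXTT product_measure1E//.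
  by rewrite /= /distribution /pushforward !preimage_setT !probability_setT mule1 ltry.
- exact: setring_rectangle_union.
move=> _ [K [L [p [q [S [mp mq ->]]]]]].
have mS : measurable [set z : E1 * E2 | S (p z.1) (q z.2)].
  rewrite (_ : [set z | _] = \bigcup_(kl in [set kl : K * L | S kl.1 kl.2])
      ((p @^-1` [set kl.1]) `*` (q @^-1` [set kl.2]))).
    by apply: fin_bigcup_measurable => // kl _; exact: measurableX.
  apply/seteqP; split=> [z Sz|z [kl /= Skl [/= -> ->]]//].
  by exists (p z.1, q z.2).
split => //.
have -> : m1 [set z | S (p z.1) (q z.2)] = (\sum_(k : K) \sum_(l : L | S k l)
    m1 ((p @^-1` [set k]) `*` (q @^-1` [set l])))%E.
  exact: (measure_rectangle_union (distribution P XY)).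
have -> : m2 [set z | S (p z.1) (q z.2)] = (\sum_(k : K) \sum_(l : L | S k l)
    m2 ((p @^-1` [set k]) `*` (q @^-1` [set l])))%E.
  exact: (measure_rectangle_union
    [the {measure set _ -> \bar R} of (distribution P X \x distribution P Y)%E]).
have m2E k l : m2 ((p @^-1` [set k]) `*` (q @^-1` [set l])) =
    (P ((p \o X) @^-1` [set k]) * P ((q \o Y) @^-1` [set l]))%E.
  by rewrite /m2 product_measure1E.
have betapq := le_trans (beta_dep_fibers (p := p \o X) (q := q \o Y)
  (fun k => XA _ (mp k)) (fun l => YB _ (mq l))) betab.
apply: le_trans (leeD2l _ betapq).
rewrite -big_split/=; apply: lee_sum => k _.
(* On a cell selected by [S] the gap is at most its absolute value; on the other cells the left side
   is 0. *)
rewrite [X in (X <= _)%E]big_mkcond [X in (_ <= X + _)%E]big_mkcond -big_split/=.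
apply: lee_sum => l _; case: ifPn => _; last by rewrite add0e abse_ge0.
rewrite m2E -leeBlDl; first exact: lee_abs.
rewrite fin_numM//; apply: fin_num_measure; rewrite comp_preimage -[X in measurable X]setTI;
  exact: measurable_funPT.
Qed.

End decoupling.

Lemma beta_depC d (W : measurableType d) (R : realType) (P : probability W R)
    (FA FB : set (set W)) : (beta_dep P FA FB <= beta_dep P FB FA)%E.
Proof.
apply: le_ereal_sup => _ [m [n [U [V [pU pV UA VB ->]]]]].
exists n, m, V, U; split=> //; rewrite exchange_big.
by apply: eq_bigr => j _; apply: eq_bigr => i _; rewrite setIC muleC.
Qed.

Lemma bounded_integrable d (T : measurableType d) (R : realType) (P : probability T R)
    (f : T -> R) (M : R) :
  measurable_fun setT f -> (forall x, `|f x| <= M) -> P.-integrable setT (EFin \o f).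
Proof.
move=> mf fM; apply: measurable_bounded_integrable => //.
  by apply: (le_lt_trans (probability_le1 P measurableT)); rewrite ltry.
by exists M; split; [exact: num_real|move=> N MN x _; exact: (le_trans (fM x)) (ltW MN)].
Qed.

Section decouple_bounds.
Context {d : measure_display} {W : measurableType d} {R : realType} (P : probability W R).
Variables (d1 d2 : measure_display) (E1 : measurableType d1) (E2 : measurableType d2).
Variables (X : {mfun W >-> E1}) (Y : {mfun W >-> E2}).
Variables (FA FB : set (set W)) (b : R) (E : set (E1 * E2)).
Hypothesis XA : forall B, measurable B -> FA (X @^-1` B).
Hypothesis YB : forall B, measurable B -> FB (Y @^-1` B).
Hypothesis betab : (beta_dep P FA FB <= b%:E)%E.
Hypothesis mE : measurable E.

Lemma measurable_fun_section :
  measurable_fun setT ((fun w => P [set w' | E (X w, Y w')]) : W -> \bar R).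
Proof.
rewrite [X in measurable_fun _ X](_ : _ = (distribution P Y \o xsection E) \o X); last first.
  apply/funext => w /=; rewrite /distribution /pushforward; congr (P _).
  by apply/seteqP; split=> w' /=; rewrite /xsection /= inE.
by apply: measurableT_comp => //; exact: measurable_fun_xsection.
Qed.

Lemma decouple_bound (c : R) : (forall w, P [set w' | E (X w, Y w')] <= c%:E)%E ->
  (P [set w | E (X w, Y w)] <= (c + b)%:E)%E.
Proof.
move=> Ec; apply: (le_trans (decouple XA YB betab mE)); rewrite EFinD leeD2r//.
rewrite -[leRHS]mule1 -(probability_setT P) -integral_cst//.
by apply: ge0_le_integral => //; exact: measurable_fun_section.
Qed.

End decouple_bounds.

Section decouple_swap.
Context {d : measure_display} {W : measurableType d} {R : realType} (P : probability W R).
Variables (d1 d2 : measure_display) (E1 : measurableType d1) (E2 : measurableType d2).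
Variables (X : {mfun W >-> E1}) (Y : {mfun W >-> E2}).
Variables (FA FB : set (set W)) (b : R) (E : set (E1 * E2)).
Hypothesis XA : forall B, measurable B -> FA (X @^-1` B).
Hypothesis YB : forall B, measurable B -> FB (Y @^-1` B).
Hypothesis betab : (beta_dep P FA FB <= b%:E)%E.
Hypothesis mE : measurable E.

Let E' : set (E2 * E1) := [set z | E (z.2, z.1)].

Let mE' : measurable E'.
Proof.
have m : measurable_fun setT (fun z : E2 * E1 => (z.2, z.1)).
  by apply: measurable_fun_pair; [exact: measurable_snd|exact: measurable_fst].
by have := m measurableT _ mE; rewrite setTI.
Qed.

Lemma measurable_fun_section_swap :
  measurable_fun setT ((fun w => P [set w' | E (X w', Y w)]) : W -> \bar R).
Proof. exact: (measurable_fun_section P Y X mE'). Qed.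

(** Serves to peel off the last term of a sum: its value is frozen while the earlier terms keep
    their joint law. *)
Lemma decouple_swap :
  (P [set w | E (X w, Y w)] <= \int[P]_w P [set w' | E (X w', Y w)] + b%:E)%E.
Proof. exact: (decouple (E := E') YB XA (le_trans (beta_depC _ _ _) betab)). Qed.

Lemma decouple_bound_swap (c : R) : (forall w, P [set w' | E (X w', Y w)] <= c%:E)%E ->
  (P [set w | E (X w, Y w)] <= (c + b)%:E)%E.
Proof.
exact: (decouple_bound (E := E') YB XA (le_trans (beta_depC _ _ _) betab) mE').
Qed.

End decouple_swap.

(** * Sigma-algebras generated by blocks of observations *)

Section subsigma.
Context {d d' : measure_display} {W : measurableType d} {E : measurableType d'}.
Variable Z : nat -> {mfun W >-> E}.

(* W with the coarser sigma-algebra of the Z k, k in J; taking the identity as the random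
   element avoids product spaces indexed by the block J. *)
Definition subsigma (J : set nat) : Type :=
  g_sigma_algebraType (\bigcup_(k in J) preimage_set_system setT (Z k) measurable).

HB.instance Definition _ J := Measurable.on (subsigma J).

Lemma measurable_fun_subsigma (J : set nat) (k : nat) : J k ->
  measurable_fun (setT : set (subsigma J)) (Z k).
Proof.
move=> Jk _ B mB; apply: sub_sigma_algebra; exists k => //; exists B => //.
Qed.

Lemma sub_sigma_field_of (J : set nat) : sigma_field_of Z J `<=` measurable.
Proof.
apply: smallest_sub; first exact: sigma_algebra_measurable.
move=> _ [k _ [B mB <-]]; exact: measurable_funPT.
Qed.

Lemma subsigma_preimage (J : set nat) d2 (E2 : measurableType d2) (X : W -> E2) :
  measurable_fun (setT : set (subsigma J)) X ->
  forall B, measurable B -> sigma_field_of Z J (X @^-1` B).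
Proof. by move=> mX B mB; have := mX measurableT B mB; rewrite setTI. Qed.

Lemma subsigma_measurable (J : set nat) d2 (E2 : measurableType d2) (X : W -> E2) :
  measurable_fun (setT : set (subsigma J)) X -> measurable_fun (setT : set W) X.
Proof.
by move=> mX _ B mB; apply: (sub_sigma_field_of (J := J)); apply: mX.
Qed.

Lemma subsigma_mono (J J' : set nat) d2 (E2 : measurableType d2) (X : W -> E2) : J `<=` J' ->
  measurable_fun (setT : set (subsigma J)) X -> measurable_fun (setT : set (subsigma J')) X.
Proof.
move=> JJ' mX _ B mB; have := mX measurableT B mB; rewrite !setTI.
apply: sub_sigma_algebra2 => A [k Jk ZA]; exists k => //; exact: JJ'.
Qed.

Lemma measurable_fun_id_subsigma (J : set nat) :
  measurable_fun (setT : set W) (id : W -> subsigma J).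
Proof. by move=> _ B mB; rewrite setTI; exact: (sub_sigma_field_of (J := J)). Qed.

Definition id_subsigma (J : set nat) : {mfun W >-> subsigma J} :=
  mfun_Sub (mem_set (@measurable_fun_id_subsigma J)).

Lemma id_subsigma_preimage (J : set nat) (B : set (subsigma J)) :
  measurable B -> sigma_field_of Z J (id_subsigma J @^-1` B).
Proof. by []. Qed.

End subsigma.

(** From [1 - x <= expR (- x)] follows [expR x <= 1 / (1 - x)], and [(1 - x) (1 + x + 2 x^2) = 1 +
    x^2 (1 - 2 x) >= 1] on this range. *)
Lemma expR_quadratic (R : realType) (x : R) : `|x| <= 2^-1 -> expR x <= 1 + x + 2 * x ^+ 2.
Proof.
move=> x2; have : `|x| < 1 by lra.
rewrite ler_norml in x2; move/andP: x2 => [xl xr] _.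
have e0 := expR_gt0 x; have := expR_ge1Dx (- x); rewrite expRN => h.
have : (1 - x) * expR x <= 1 by rewrite -ler_pdivlMr// div1r.
nra.
Qed.

(** * Deviations of sums over well separated indices *)

Lemma integral_affine d (T : measurableType d) (R : realType) (P : probability T R)
    (f : T -> R) (M m c0 c1 : R) : measurable_fun setT f -> (forall x, `|f x| <= M) ->
  (\int[P]_x (f x)%:E = m%:E -> \int[P]_x (c0 + c1 * f x)%:E = (c0 + c1 * m)%:E)%E.
Proof.
move=> mf fM f0; have fint := bounded_integrable P mf fM.
under eq_integral do rewrite EFinD EFinM.
rewrite integralD//; last exact: (integrableZl measurableT c1 fint).
- rewrite integralZl// f0 integral_cst//.
  by rewrite [X in (_ * X + _)%E](_ : _ = 1%E) ?mule1//; exact: probability_setT.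
- exact: finite_measure_integrable_cst.
Qed.

Lemma measurable_set_gt d (T : measurableType d) (R : realType) (f : T -> R) (c : R) :
  measurable_fun setT f -> measurable [set x | c < f x].
Proof.
move=> mf; rewrite (_ : [set x | _] = setT `&` f @^-1` `]c, +oo[).
  by apply: mf => //; exact: measurable_itv.
by rewrite setTI; apply/seteqP; split=> x /=; rewrite in_itv/= andbT.
Qed.

(** All that the estimates for a fixed row take from absolute regularity: its coefficient at the
    single lag [q]. *)
Definition mixing_bound {d d' : measure_display} {R : realType} {W : measurableType d}
    {E : measurableType d'} (P : probability W R) (Z : nat -> {mfun W >-> E})
    (T q : nat) (b : R) : Prop :=
  forall n, (beta_dep P (sigma_field_of Z [set k | (1 <= k <= n)%N])
    (sigma_field_of Z [set k | (1 <= k)%N /\ (n + q <= k <= T)%N]) <= b%:E)%E.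

Section progression.
Context {d d' : measure_display} {R : realType} {W : measurableType d} {E : measurableType d'}.
Variables (P : probability W R) (Z : nat -> {mfun W >-> E}) (T q : nat) (b : R).
Hypothesis mixZ : mixing_bound P Z T q b.
Hypothesis b0 : 0 <= b.
Hypothesis q0 : (0 < q)%N.

Variables (h : nat -> E -> R) (a : nat) (lambda : R).
Hypothesis mh : forall u, measurable_fun setT (h u).
Hypothesis h1 : forall u x, `|h u x| <= 1.
Hypothesis hT : forall u x, (T < u)%N -> h u x = 0.
Hypothesis h0 : forall u, (\int[P]_w (h u (Z u w))%:E = 0)%E.
Hypothesis qa : (q <= a)%N.
Hypothesis lambda2 : 0 <= lambda <= 2^-1.

Let S k w := \sum_(s < k) h (a + q * s) (Z (a + q * s)%N w).

(** Induction on [k]. The last term is [q] away from the others, so at cost [b] its value may be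
    frozen and the induction hypothesis used at the threshold lowered by that value. Working with
    tail probabilities rather than exponential moments makes the errors [b] add up instead of being
    multiplied by exponentials. *)
Lemma progression_deviation k (c : R) :
  (P [set w | (c < S k w)%R] <= (k%:R * b + expR (- lambda * c) * (1 + 2 * lambda ^+ 2) ^+ k)%:E)%E.
Proof.
have [l0 l2] := andP lambda2.
have mS k0 : measurable_fun (setT : set W) (S k0).
  by apply: measurable_sum => s; exact: measurableT_comp.
set B := 1 + 2 * lambda ^+ 2.
have B1 : 1 <= B by rewrite /B lerDl mulr_ge0// sqr_ge0.
elim: k c => [|k IHk] c.
  rewrite mul0r add0r expr0 mulr1; have [c0|c0] := ltP c 0.
    apply: (le_trans (probability_le1 _ _)).
      exact: measurable_set_gt.
    rewrite lee_fin -expR0 ler_expR; nra.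
  rewrite [X in P X](_ : _ = set0) ?measure0 ?lee_fin ?expR_ge0//.
  by apply/seteqP; split=> w //=; rewrite /S big_ord0; lra.
set C := expR (- lambda * c) * B ^+ k.
have C0 : 0 <= C by rewrite mulr_ge0 ?expR_ge0// exprn_ge0//; lra.
have -> : expR (- lambda * c) * B ^+ k.+1 = C * B by rewrite exprSr mulrA.
(* A term with index beyond [T] vanishes: the sum is unchanged while the bound grows. *)
have [Tu|uT] := ltnP T (a + q * k).
  rewrite [X in P X](_ : _ = [set w | c < S k w]); last first.
    by apply/seteqP; split=> w /=; rewrite /S big_ord_recr/= hT// addr0.
  apply: (le_trans (IHk c)); rewrite lee_fin.
  by apply: lerD; [rewrite ler_wpM2r// ler_nat|rewrite ler_peMr].
set u := (a + q * k)%N in uT *.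
set J := [set v | (1 <= v <= u - q)%N].
have mSJ : measurable_fun (setT : set (subsigma Z J)) (S k).
  apply: (@measurable_sum _ (subsigma Z J)) => s; apply: measurableT_comp => //.
  apply: measurable_fun_subsigma; rewrite /J /u /=.
  have := ltn_ord s; nia.
pose X : {mfun W >-> R} := mfun_Sub (mem_set (mS k)).
have mD : measurable [set z : R * E | c < z.1 + h u z.2].
  apply: measurable_set_gt; apply: measurable_funD; first exact: measurable_fst.
  exact: measurableT_comp.
have XA := subsigma_preimage mSJ.
have mZu : measurable_fun
    (setT : set (subsigma Z [set v | (1 <= v)%N /\ (u - q + q <= v <= T)%N])) (Z u).
  by apply: measurable_fun_subsigma; rewrite /= /u; lia.
have ZB := subsigma_preimage mZu.
have := decouple_swap (X := X) (Y := Z u) XA ZB (mixZ _) mD.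
rewrite [X in P X](_ : _ = [set w | c < S k.+1 w]); last first.
  by apply/seteqP; split => w /=; rewrite /S big_ord_recr.
move=> /le_trans; apply.
(* With [x = h u (Z u w)] and [|x| <= 1], [expR (lambda * x) <= 1 + lambda * x + 2 * (lambda * x)^2
   <= B + lambda * x]. The majorant is affine in [x], so centering removes its linear term on
   integration. *)
pose f w := k%:R * b + C * B + C * lambda * h u (Z u w).
have mf : measurable_fun setT f.
  by apply: measurable_funD => //; apply: measurable_funM => //; exact: measurableT_comp.
apply: (@le_trans _ _ (\int[P]_w (f w)%:E + b%:E)%E).
  rewrite leeD2r//; apply: ge0_le_integral => //.
  - exact: (measurable_fun_section_swap P X (Z u) mD).
  - exact/measurable_EFinP.
  move=> w _; rewrite [X in P X](_ : _ = [set w' | c - h u (Z u w) < S k w']); last first.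
    by apply/seteqP; split => w' /=; rewrite ltrBlDr.
  apply: (le_trans (IHk _)); rewrite lee_fin /f -addrA lerD2l.
  have -> : - lambda * (c - h u (Z u w)) = - lambda * c + lambda * h u (Z u w) by ring.
  rewrite expRD mulrAC -/C -mulrA -mulrDr ler_wpM2l//.
  have := h1 u (Z u w); set x := h u _ => x1.
  have x2 : x ^+ 2 <= 1 by rewrite -[x ^+ 2]ger0_norm ?sqr_ge0// normrX exprn_ile1.
  apply: (@le_trans _ _ (1 + lambda * x + 2 * (lambda * x) ^+ 2)).
    by apply: expR_quadratic; rewrite normrM (ger0_norm l0); nra.
  have := ler_wpM2l (sqr_ge0 lambda) x2; rewrite /B exprMn; lra.
rewrite (integral_affine (M := 1) (m := 0))//; last exact: measurableT_comp.
by rewrite mulr0 addr0 -EFinD lee_fin -natr1 mulrDl mul1r addrAC.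
Qed.

End progression.

(** Avoids the factor [#|I|] of a union bound. Terms with [|f i| <= e] contribute at most [e #|I|],
    so on the event [K] times the number of the other indices is at least [e #|I|]; Markov's
    inequality for that number gives the bound. *)
Lemma markov_average d (W : measurableType d) (R : realType) (P : probability W R)
    (I : finType) (f : I -> W -> R) (K e eta : R) :
  0 < e -> 0 <= eta -> 0 <= K -> (forall i, measurable_fun setT (f i)) ->
  (forall i w, `|f i w| <= K) ->
  (forall i, (P [set w | (e < `|f i w|)%R] <= eta%:E)%E) ->
  (P [set w | (2 * e * #|I|%:R < \sum_(i : I) `|f i w|)%R] <= (K * eta / e)%:E)%E.
Proof.
move=> e0 eta0 K0 mf fK Pf.
pose B i := [set w | e < `|f i w|].
have mB i : measurable (B i) by apply: measurable_set_gt; exact: measurableT_comp.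
have mA : measurable [set w | 2 * e * #|I|%:R < \sum_(i : I) `|f i w|].
  by apply: measurable_set_gt; apply: measurable_sum => i; exact: measurableT_comp.
have Ke0 : (0 <= (K * eta / e)%:E)%E by rewrite lee_fin divr_ge0 ?mulr_ge0// ltW.
have [I0|I0] := posnP #|I|.
  rewrite [X in P X](_ : _ = set0) ?measure0//.
  apply/seteqP; split=> w //=; rewrite I0 mulr0 big1 ?ltxx// => i _.
  by have := card0_eq I0 i; rewrite inE.
have n0 : 0 < #|I|%:R :> R by rewrite ltr0n.
pose C := K / (e * #|I|%:R).
have C0 : 0 <= C by rewrite divr_ge0// mulr_ge0// ltW.
apply: (@le_trans _ _ (\int[P]_w (\sum_(i : I) C%:E * (\1_(B i) w)%:E))%E).
  rewrite -[X in P X]setIT -integral_indic//; apply: ge0_le_integral => //.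
  - exact/measurable_EFinP/measurable_indic.
  - apply: emeasurable_sum => i; apply/measurable_EFinP.
    by apply: measurable_funM => //; exact: measurable_indic.
  move=> w _; rewrite sumEFin lee_fin -mulr_sumr [X in X <= _]indicE.
  case: (boolP (w \in _)) => [|_]; last first.
    by rewrite mulr_ge0// sumr_ge0.
  rewrite inE /= => Aw.
  have : \sum_(i : I) `|f i w| <= e * #|I|%:R + K * \sum_(i : I) \1_(B i) w.
    rewrite mulr_natr -sumr_const mulr_sumr -big_split/=; apply: ler_sum => i _.
    rewrite indicE; case: (boolP (w \in _)) => [_|]; first by rewrite mulr1 ler_wpDl// ltW.
    by move=> /negP; rewrite inE /B /= mulr0 addr0 => /negP; rewrite -leNgt.
  rewrite /C mulrAC ler_pdivlMr ?mulr_gt0// mul1r; nra.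
rewrite ge0_integral_sum//; last 2 first.
- move=> i; apply/measurable_EFinP; apply: measurable_funM => //; exact: measurable_indic.
- by move=> i w _; rewrite lee_fin mulr_ge0.
apply: (@le_trans _ _ (\sum_(i : I) (C * eta)%:E)%E).
  apply: lee_sum => i _; rewrite integralZl//; last first.
    apply: (@bounded_integrable _ _ _ P (\1_(B i)) 1); first exact: measurable_indic.
    by move=> w; rewrite indicE; case: (_ \in _); rewrite ?normr1// normr0.
  by rewrite integral_indic// setIT (EFinM C); apply: lee_wpmul2l => //; exact: Pf.
rewrite sumEFin lee_fin sumr_const -mulr_natr /C le_eqVlt; apply/orP; left; apply/eqP.
by field; rewrite !gt_eqF.
Qed.

(** The progressions of [k] terms starting at [q + a], [a < q], tile the integers from [q] to
    [q + q k - 1], a range that passes [T]. Starting at [q] meets the condition [q <= a] of the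
    progression bound. *)
Lemma sum_progressions (V : zmodType) (G : nat -> V) (T q k : nat) :
  (0 < q)%N -> (T <= k * q)%N -> (forall u, (u < q)%N -> G u = 0) ->
  (forall u, (T < u)%N -> G u = 0) ->
  \sum_(1 <= u < T.+1) G u = \sum_(a < q) \sum_(s < k) G (q + a + q * s)%N.
Proof.
move=> q0 Tkq Gq GT.
have -> : \sum_(a < q) \sum_(s < k) G (q + a + q * s)%N = \sum_(q <= u < q + q * k) G u.
  rewrite exchange_big /=; elim: k {Tkq} => [|k IHk].
    by rewrite big_ord0 muln0 addn0 big_geq.
  rewrite big_ord_recr/= IHk (@big_cat_nat _ _ _ (q + q * k) q (q + q * k.+1)) ?leq_addr//=;
    last lia.
  congr (_ + _); rewrite -{1}[(q + q * k)%N]add0n big_addn mulnS.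
  rewrite (_ : (q + (q + q * k) - (q + q * k))%N = q); last lia.
  by rewrite big_mkord; apply: eq_bigr => a _; congr G; lia.
rewrite [RHS](_ : _ = \sum_(1 <= u < q + q * k) G u); last first.
  rewrite [RHS](@big_cat_nat _ _ _ q)//=; last lia.
  rewrite [X in _ = X + _]big1_seq ?add0r// => u.
  by rewrite mem_index_iota => /andP[_ /andP[_ /Gq]].
rewrite [RHS](@big_cat_nat _ _ _ T.+1)//=; last lia.
by rewrite [X in _ = _ + X]big1_seq ?addr0// => u; rewrite mem_index_iota => /andP[_ /andP[/GT]].
Qed.

(* The Chernoff bound along one progression, after Markov's inequality over the residues. *)
Definition deviation_bound {R : realType} (k : nat) (b e : R) : R :=
  2 * (k%:R * b + expR (- (e ^+ 2 / 8 * k%:R))) / e.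

Lemma deviation_bound_ge0 {R : realType} (k : nat) (b e : R) :
  0 <= b -> 0 <= e -> 0 <= deviation_bound k b e.
Proof.
by move=> b0 e0; rewrite /deviation_bound divr_ge0// mulr_ge0// addr_ge0 ?expR_ge0// mulr_ge0.
Qed.

Lemma sum_nat_in_le (R : numDomainType) (T a n : nat) :
  \sum_(1 <= u < T.+1) ((a <= u < a + n)%N)%:R <= n%:R :> R.
Proof.
rewrite -natr_sum ler_nat.
rewrite (eq_bigr (fun u => if a <= u < a + n then 1 else 0)%N); last by move=> u _; case: ifP.
rewrite -big_mkcond/= sum1_count -size_filter -[leqRHS](size_iota a).
apply: uniq_leq_size; first by rewrite filter_uniq// iota_uniq.
by move=> u; rewrite mem_filter mem_iota => /andP[].
Qed.

(** The index [u] is an argument because the law changes after [M]. Centering is asked at fixed [x]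
    and [y], since decoupling turns the two outer observations into constants. *)
Definition centered_kernel {d d' : measure_display} {R : realType} {W : measurableType d}
    {E : measurableType d'} (P : probability W R) (Z : nat -> {mfun W >-> E}) (T : nat)
    (phi : nat -> E -> E -> E -> R) : Prop :=
  [/\ forall u, measurable_fun setT (fun z : E * E * E => phi u z.1.1 z.1.2 z.2),
      forall u x y z, `|phi u x y z| <= 1 &
      forall u x y, (1 <= u <= T)%N -> (\int[P]_w (phi u x y (Z u w))%:E = 0)%E].

(** * Deviations with two frozen observations, within one row *)

Section mixing_row.
Context {d d' : measure_display} {R : realType} {W : measurableType d} {E : measurableType d'}.
Variables (P : probability W R) (Z : nat -> {mfun W >-> E}) (T q k : nat) (b e : R).
Hypothesis mixZ : mixing_bound P Z T q b.
Hypothesis b0 : 0 <= b.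
Hypothesis q0 : (0 < q)%N.
Hypothesis k0 : (0 < k)%N.
Hypothesis Tkq : (T <= k * q)%N.
Hypothesis e01 : 0 < e <= 1.

Lemma progression_two_sided (h : nat -> E -> R) (a : nat) :
  (forall u, measurable_fun setT (h u)) -> (forall u x, `|h u x| <= 1) ->
  (forall u x, (T < u)%N -> h u x = 0) -> (forall u, (\int[P]_w (h u (Z u w))%:E = 0)%E) ->
  (q <= a)%N ->
  (P [set w | (e < `|(k%:R)^-1 * \sum_(s < k) h (a + q * s)%N (Z (a + q * s)%N w)|)%R] <=
    (2 * (k%:R * b + expR (- (e ^+ 2 / 8 * k%:R))))%:E)%E.
Proof.
move=> mh h1 hT h0 qa; have [e0 e1] := andP e01.
have kR : 0 < k%:R :> R by rewrite ltr0n.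
pose S (g : nat -> E -> R) w := \sum_(s < k) g (a + q * s)%N (Z (a + q * s)%N w).
have one (g : nat -> E -> R) :
    (forall u, measurable_fun setT (g u)) -> (forall u x, `|g u x| <= 1) ->
    (forall u x, (T < u)%N -> g u x = 0) -> (forall u, (\int[P]_w (g u (Z u w))%:E = 0)%E) ->
    (P [set w | (e * k%:R < S g w)%R] <= (k%:R * b + expR (- (e ^+ 2 / 8 * k%:R)))%:E)%E.
  move=> mg g1 gT g0.
  (* The exponent [- lambda e k + 2 lambda^2 k] is smallest at [lambda = e / 4], where it equals
     [- e^2 k / 8]. *)
  have l2 : 0 <= e / 4 <= 2^-1 by apply/andP; split; lra.
  apply: (le_trans (progression_deviation mixZ b0 q0 mg g1 gT g0 qa l2 k (e * k%:R))).
  rewrite lee_fin lerD2l.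
  have Bexp : 1 + 2 * (e / 4) ^+ 2 <= expR (2 * (e / 4) ^+ 2) by exact: expR_ge1Dx.
  apply: (@le_trans _ _ (expR (- (e / 4) * (e * k%:R)) * expR (2 * (e / 4) ^+ 2) ^+ k)).
    rewrite ler_wpM2l ?expR_ge0// lerXn2r// nnegrE ?expR_ge0// addr_ge0// mulr_ge0// sqr_ge0.
    done.
  rewrite -expRM_natr -expRD ler_expR; lra.
have mS (g : nat -> E -> R) : (forall u, measurable_fun setT (g u)) -> measurable_fun setT (S g).
  by move=> mg; apply: measurable_sum => s; exact: measurableT_comp.
pose h' u x := - h u x.
have mh' u : measurable_fun setT (h' u) by exact: measurableT_comp.
rewrite [X in P X](_ : _ = [set w | e * k%:R < S h w] `|` [set w | e * k%:R < S h' w]).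
  apply: (le_trans (measureU2 _ _ _)); [exact: measurable_set_gt (mS _ mh)|
    exact: measurable_set_gt (mS _ mh')|].
  rewrite mulrDl mul1r [X in (_ <= X%:E)%E](_ : _ = (k%:R * b + expR (- (e ^+ 2 / 8 * k%:R))) +
     (k%:R * b + expR (- (e ^+ 2 / 8 * k%:R)))); last by lra.
  rewrite EFinD; apply: leeD; first exact: one.
  apply: one => //.
  - by move=> u x; rewrite normrN.
  - by move=> u x /hT; rewrite /h' => ->; rewrite oppr0.
  - move=> u; under eq_integral do rewrite -[h' _ _]mul1r -[_ * _]add0r /h' mulrN -mulNr.
    rewrite (integral_affine (M := 1) (m := 0))//; last exact: measurableT_comp.
    by rewrite mulr0 addr0.
have SN w : S h' w = - S h w by rewrite /S -sumrN.
apply/seteqP; split=> w /=; rewrite -/(S h w) normrM gtr0_norm ?invr_gt0// ltr_pdivlMl//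
  mulrC SN lter_normr.
- by move=> /orP.
- by move=> h01; apply/orP.
Qed.

(** The [q] residues enter through [markov_average]: the failure probability is that of one
    progression divided by [e], not multiplied by [q]. *)
Lemma interval_deviation (h : nat -> E -> R) :
  (forall u, measurable_fun setT (h u)) -> (forall u x, `|h u x| <= 1) ->
  (forall u x, (T < u)%N -> h u x = 0) -> (forall u x, (u < q)%N -> h u x = 0) ->
  (forall u, (\int[P]_w (h u (Z u w))%:E = 0)%E) ->
  (P [set w | (2 * e * (k * q)%:R < `|\sum_(1 <= u < T.+1) h u (Z u w)|)%R] <=
    (deviation_bound k b e)%:E)%E.
Proof.
move=> mh h1 hT hq h0; have [e0 e1] := andP e01.
pose f (a : 'I_q) w := (k%:R)^-1 * \sum_(s < k) h (q + a + q * s)%N (Z (q + a + q * s)%N w).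
have kR : 0 < k%:R :> R by rewrite ltr0n.
have mf a : measurable_fun setT (f a).
  apply: measurable_funM => //; apply: measurable_sum => s; exact: measurableT_comp.
have f1 a w : `|f a w| <= 1.
  rewrite normrM gtr0_norm ?invr_gt0// ler_pdivrMl// mulr1.
  apply: (le_trans (ler_norm_sum _ _ _)).
  by rewrite -[X in _ <= X%:R]card_ord -sumr_const; apply: ler_sum.
pose eta := 2 * (k%:R * b + expR (- (e ^+ 2 / 8 * k%:R))).
have eta0 : 0 <= eta by rewrite mulr_ge0// addr_ge0 ?expR_ge0// mulr_ge0// ltW.
have := @markov_average _ _ _ P _ f 1 e eta e0 eta0 ler01 mf f1
  (fun a => progression_two_sided mh h1 hT h0 (leq_addr a q)).
rewrite card_ord mul1r -/(deviation_bound k b e); apply: le_trans.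
apply: le_measure; rewrite ?inE.
- apply: measurable_set_gt; apply: measurableT_comp => //.
  by apply: measurable_sum => u; exact: measurableT_comp.
- by apply: measurable_set_gt; apply: measurable_sum => a; exact: measurableT_comp.
move=> w /=; rewrite (sum_progressions (G := fun u => h u (Z u w)) q0 Tkq); last 2 first.
- by move=> u uq; exact: hq.
- by move=> u uT; exact: hT.
move=> lt; have : `|\sum_(a < q) \sum_(s < k) h (q + a + q * s)%N (Z (q + a + q * s)%N w)| <=
    k%:R * \sum_(a < q) `|f a w|.
  rewrite mulr_sumr; apply: (le_trans (ler_norm_sum _ _ _)); apply: ler_sum => a _.
  by rewrite /f normrM gtr0_norm ?invr_gt0// mulrA mulfV ?mul1r// gt_eqF.
move=> /(lt_le_trans lt).
have -> : 2 * e * (k * q)%:R = k%:R * (2 * e * q%:R) by rewrite natrM; ring.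
by rewrite ltr_pM2l.
Qed.

(** [X] depends on the past up to [n1], [Y] on the future from [n2], and only indices at distance at
    least [q] from both contribute. Two decouplings, each costing [b], turn [X] and [Y] into
    constants and leave [interval_deviation]. *)
Lemma frozen_deviation d1 d2 (E1 : measurableType d1) (E2 : measurableType d2)
    (X : W -> E1) (Y : W -> E2) (n1 n2 : nat) (phi : nat -> E1 -> E2 -> E -> R) :
  (forall u, measurable_fun setT (fun z : E1 * E2 * E => phi u z.1.1 z.1.2 z.2)) ->
  (forall u x y z, `|phi u x y z| <= 1) ->
  (forall u x y, (\int[P]_w (phi u x y (Z u w))%:E = 0)%E) ->
  (forall u x y z, ~~ [&& n1 + q <= u, u + q <= n2 & u <= T]%N -> phi u x y z = 0) ->
  measurable_fun (setT : set (subsigma Z [set v | (1 <= v <= n1)%N])) X ->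
  measurable_fun (setT : set (subsigma Z [set v | (1 <= v)%N /\ (n2 <= v <= T)%N])) Y ->
  (P [set w | (2 * e * (k * q)%:R < `|\sum_(1 <= u < T.+1) phi u (X w) (Y w) (Z u w)|)%R] <=
    (deviation_bound k b e + 2 * b)%:E)%E.
Proof.
move=> mphi phi1 phi0 phiN mX mY; have [e0 e1] := andP e01.
set c := 2 * e * (k * q)%:R.
have c0 : 0 <= c by rewrite !mulr_ge0// ltW.
have D0 : 0 <= deviation_bound k b e.
  by rewrite deviation_bound_ge0// ltW.
have [n12|n12] := ltnP n2 (n1 + q + q).
  rewrite [X in P X](_ : _ = set0) ?measure0 ?lee_fin; last first.
    apply/seteqP; split=> w //=; rewrite big1 ?normr0 ?ltNge ?c0// => u _.
    by apply: phiN; lia.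
  by rewrite addr_ge0// mulr_ge0.
(* [J1] carries [X] and every contributing observation, and ends [q] before [n2]; [J2] contains the
   contributing observations and starts [q] after [n1]. *)
set J1 := [set v | (1 <= v <= n2 - q)%N].
set J2 := [set v | (1 <= v)%N /\ (n1 + q <= v <= T)%N].
have mW1 := subsigma_measurable mX.
have mW2 := subsigma_measurable mY.
pose X' : {mfun W >-> E1} := mfun_Sub (mem_set mW1).
pose Y' : {mfun W >-> E2} := mfun_Sub (mem_set mW2).
have mX1 : measurable_fun (setT : set (subsigma Z J1)) X.
  by apply: subsigma_mono mX => v; rewrite /J1 /=; lia.
have mY1 : measurable_fun
    (setT : set (subsigma Z [set v | (1 <= v)%N /\ (n2 - q + q <= v <= T)%N])) Y.
  by apply: subsigma_mono mY => v /=; lia.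
(* Measurability for the coarse sigma-algebra is asked only of observations inside the window; the
   terms outside are identically 0. *)
have comp d3 (E3 : measurableType d3) (f1 : E3 -> E1) (f2 : E3 -> E2) (g : nat -> E3 -> E) :
    measurable_fun setT f1 -> measurable_fun setT f2 ->
    (forall u, [&& n1 + q <= u, u + q <= n2 & u <= T]%N -> measurable_fun setT (g u)) ->
    measurable [set z | c < `|\sum_(1 <= u < T.+1) phi u (f1 z) (f2 z) (g u z)|].
  move=> mf1 mf2 mg; apply: measurable_set_gt; apply: measurableT_comp => //.
  apply: measurable_sum => u.
  have [/mg mgu|Nu] := boolP [&& n1 + q <= u, u + q <= n2 & u <= T]%N.
    apply: (measurableT_comp (mphi u) (g := fun z => (f1 z, f2 z, g u z))).
    by apply: measurable_fun_pair => //; exact: measurable_fun_pair.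
  by rewrite (_ : (fun z => _) = cst 0)//; apply/funext => z; exact: phiN.
have mE1 : measurable [set z : subsigma Z J1 * E2 |
    c < `|\sum_(1 <= u < T.+1) phi u (X z.1) z.2 (Z u z.1)|].
  apply: (comp _ _ (fun z : subsigma Z J1 * E2 => X z.1) snd (fun u z => Z u z.1)).
  - exact: measurableT_comp.
  - exact: measurable_snd.
  - move=> u Ju; apply: (measurableT_comp (f := Z u : subsigma Z J1 -> E)) => //.
    by apply: measurable_fun_subsigma; rewrite /J1 /=; lia.
(* Y is decoupled from X and the observations jointly, then X from the observations. *)
rewrite mulr_natl mulr2n addrA.
apply: (decouple_bound_swap (X := id_subsigma Z J1) (Y := Y')
  (@id_subsigma_preimage _ _ _ _ Z _) (subsigma_preimage mY1) (mixZ _) mE1) => w0 /=.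
move: (Y w0) => y {w0}.
have mE2 : measurable [set z : E1 * subsigma Z J2 |
    c < `|\sum_(1 <= u < T.+1) phi u z.1 y (Z u z.2)|].
  apply: (comp _ _ fst (cst y) (fun u z => Z u (z.2 : subsigma Z J2))) => //.
  move=> u Ju; apply: (measurableT_comp (f := Z u : subsigma Z J2 -> E)) => //.
  by apply: measurable_fun_subsigma; rewrite /J2 /=; lia.
apply: (decouple_bound (X := X') (Y := id_subsigma Z J2)
  (subsigma_preimage mX) (@id_subsigma_preimage _ _ _ _ Z _) (mixZ _) mE2) => w0 /=.
move: (X w0) => x {w0}.
apply: (interval_deviation (h := fun u z => phi u x y z)) => //.
- move=> u; apply: (measurableT_comp (mphi u) (g := fun z => (x, y, z))).
  by apply: measurable_fun_pair.
- by move=> u z Tu; apply: phiN; lia.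
- by move=> u z uq; apply: phiN; lia.
Qed.

(** The windows [L], [M], [N] lie left of [i], between [i] and [j], and right of [j], at distance
    [q] from both. Each falls under [frozen_deviation], a constant in [unit] standing for an absent
    past or future. Three windows with threshold [2 e k q] give the 6. *)
Let ordered_pair_deviation (i j : nat) (phi : nat -> E -> E -> E -> R) :
  centered_kernel P Z T phi -> (1 <= i <= j)%N -> (j <= T)%N ->
  (P [set w | (6 * e * (k * q)%:R + 5 * q%:R <
       `|\sum_(1 <= u < T.+1) phi u (Z i w) (Z j w) (Z u w)|)%R] <=
    (3 * (deviation_bound k b e + 2 * b))%:E)%E.
Proof.
move=> [mphi phi1 phi0] ij jT.
pose L u := (q <= u)%N && (u + q <= i)%N.
pose M u := (i + q <= u)%N && (u + q <= j)%N.
pose N u := (j + q <= u)%N && (u <= T)%N.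
have disj v : [/\ L v -> M v = false, L v -> N v = false & M v -> N v = false].
  by rewrite /L /M /N; clear -ij q0; split; lia.
pose restr (C : pred nat) u x y z := if C u then phi u x y z else 0.
have restr1 C u x y z : `|restr C u x y z| <= 1.
  by rewrite /restr; case: ifP => // _; rewrite normr0.
have restr0 (C : pred nat) u x y : (C u -> 1 <= u <= T)%N ->
    (\int[P]_w (restr C u x y (Z u w))%:E = 0)%E.
  by rewrite /restr; case: (C u) => [h|_]; [exact/phi0/h|exact: integral0_eq].
have mrestr C u : measurable_fun setT (fun z : E * E * E => restr C u z.1.1 z.1.2 z.2).
  by rewrite /restr; case: (C u).
have mZ J v : J v -> measurable_fun (setT : set (subsigma Z J)) (Z v).
  exact: measurable_fun_subsigma.
pose S C w := \sum_(1 <= u < T.+1) restr C u (Z i w) (Z j w) (Z u w).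
set c := 2 * e * (k * q)%:R.
have mS C : measurable [set w | c < `|S C w|].
  apply: measurable_set_gt; apply: measurableT_comp => //; apply: measurable_sum => u.
  apply: (measurableT_comp (mrestr C u) (g := fun w => (Z i w, Z j w, Z u w))).
  by apply: measurable_fun_pair => //; exact: measurable_fun_pair.
set B := deviation_bound k b e + 2 * b.
have PL : (P [set w | (c < `|S L w|)%R] <= B%:E)%E.
  apply: (frozen_deviation (X := fun _ : W => tt)
    (Y := fun w => (Z i w, Z j w)) (n1 := 0) (n2 := i)
    (phi := fun u _ y z => restr L u y.1 y.2 z)) => //.
  - move=> u; apply: (measurableT_comp (mrestr L u)
      (g := fun z : unit * (E * E) * E => (z.1.2.1, z.1.2.2, z.2))).
    have m12 : measurable_fun setT (fun z : unit * (E * E) * E => z.1.2).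
      by apply: measurableT_comp; [exact: measurable_snd|exact: measurable_fst].
    apply: measurable_fun_pair; last exact: measurable_snd.
    by apply: measurable_fun_pair; apply: measurableT_comp.
  - move=> u x y; apply: restr0; rewrite /L; lia.
  - by move=> u x y z; rewrite /restr /L; case: ifP => //; lia.
  - apply: measurable_fun_pair; apply: mZ => /=; lia.
have PM : (P [set w | (c < `|S M w|)%R] <= B%:E)%E.
  apply: (frozen_deviation (X := Z i)
    (Y := Z j) (n1 := i) (n2 := j) (phi := restr M)) => //.
  - move=> u x y; apply: restr0; rewrite /M; lia.
  - by move=> u x y z; rewrite /restr /M; case: ifP => //; lia.
  - apply: mZ => /=; lia.
  - apply: mZ => /=; lia.
have PN : (P [set w | (c < `|S N w|)%R] <= B%:E)%E.
  (* The absent future is placed at [T + q], so that [u + q <= n2] reads [u <= T]. *)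
  apply: (frozen_deviation (X := fun w => (Z i w, Z j w))
    (Y := fun _ : W => tt) (n1 := j) (n2 := (T + q)%N)
    (phi := fun u x _ z => restr N u x.1 x.2 z)) => //.
  - move=> u; apply: (measurableT_comp (mrestr N u)
      (g := fun z : (E * E) * unit * E => (z.1.1.1, z.1.1.2, z.2))).
    have m11 : measurable_fun setT (fun z : (E * E) * unit * E => z.1.1).
      by apply: measurableT_comp; exact: measurable_fst.
    apply: measurable_fun_pair; last exact: measurable_snd.
    by apply: measurable_fun_pair; apply: measurableT_comp.
  - move=> u x y; apply: restr0; rewrite /N; lia.
  - by move=> u x y z; rewrite /restr /N; case: ifP => //; lia.
  - apply: measurable_fun_pair; apply: mZ => /=; lia.
(* Three intervals of lengths [q - 1], [2 q] and [2 q] cover all indices missed by [L], [M], [N];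
   hence the [5 q]. If [i + 1 < q], the truncated interval starts at 0 and still contains every
   index below [i + q]. *)
pose near_ u : R := (1 <= u < 1 + (q - 1))%:R + (i + 1 - q <= u < (i + 1 - q) + 2 * q)%:R +
  (j + 1 - q <= u < (j + 1 - q) + 2 * q)%:R.
have split u x y z : (1 <= u <= T)%N ->
    `|phi u x y z - restr L u x y z - restr M u x y z - restr N u x y z| <= near_ u.
  move=> uT; have := phi1 u x y z; rewrite /restr; move: (phi u x y z) => p p1.
  have bool0 (c1 : bool) : 0 <= c1%:R :> R by [].
  have near0 : 0 <= near_ u by rewrite !addr_ge0.
  have [LM LN MN] := disj u.
  have [Lu|NL] := boolP (L u); first by rewrite (LM Lu) (LN Lu) !subr0 subrr normr0.
  have [Mu|NM] := boolP (M u); first by rewrite (MN Mu) !subr0 subrr normr0.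
  have [Nu|NN] := boolP (N u); first by rewrite !subr0 subrr normr0.
  rewrite !subr0.
  apply: (le_trans p1).
  have : [|| 1 <= u < 1 + (q - 1), i + 1 - q <= u < (i + 1 - q) + 2 * q |
      j + 1 - q <= u < (j + 1 - q) + 2 * q]%N.
    by move: NL NM NN; rewrite /L /M /N; clear -ij jT q0 uT; lia.
  move/or3P; rewrite /near_.
  have := bool0 (1 <= u < 1 + (q - 1))%N.
  have := bool0 (i + 1 - q <= u < (i + 1 - q) + 2 * q)%N.
  have := bool0 (j + 1 - q <= u < (j + 1 - q) + 2 * q)%N.
  by move=> ? ? ? []-> /=; lra.
have sum_split w : `|\sum_(1 <= u < T.+1) phi u (Z i w) (Z j w) (Z u w)| <=
    `|S L w| + `|S M w| + `|S N w| + 5 * q%:R.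
  have near5 : \sum_(1 <= u < T.+1) near_ u <= 5 * q%:R.
    rewrite !big_split/=; have := sum_nat_in_le R T 1 (q - 1).
    have := sum_nat_in_le R T (i + 1 - q) (2 * q).
    have := sum_nat_in_le R T (j + 1 - q) (2 * q).
    have : (q - 1)%:R <= q%:R :> R by rewrite ler_nat leq_subr.
    rewrite natrM; lra.
  pose rest u := phi u (Z i w) (Z j w) (Z u w) - restr L u (Z i w) (Z j w) (Z u w) -
    restr M u (Z i w) (Z j w) (Z u w) - restr N u (Z i w) (Z j w) (Z u w).
  have rest5 : `|\sum_(1 <= u < T.+1) rest u| <= 5 * q%:R.
    apply: (le_trans (ler_norm_sum _ _ _)); apply: le_trans near5.
    by apply: ler_sum_nat => u uT; exact: split.
  have -> : \sum_(1 <= u < T.+1) phi u (Z i w) (Z j w) (Z u w) =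
      S L w + S M w + S N w + \sum_(1 <= u < T.+1) rest u.
    by rewrite /rest !sumrB -/(S L w) -/(S M w) -/(S N w); ring.
  apply: (le_trans (ler_normD _ _)); apply: lerD => //.
  by apply: (le_trans (ler_normD _ _)); rewrite lerD2r ler_normD.
apply: (@le_trans _ _ (P ([set w | (c < `|S L w|)%R] `|` [set w | (c < `|S M w|)%R] `|` 
    [set w | (c < `|S N w|)%R]))%E).
  apply: le_measure; rewrite ?inE.
  - apply: measurable_set_gt; apply: measurableT_comp => //; apply: measurable_sum => u.
    apply: (measurableT_comp (mphi u) (g := fun w => (Z i w, Z j w, Z u w))).
    by apply: measurable_fun_pair => //; exact: measurable_fun_pair.
  - by apply: measurableU => //; exact: measurableU.
  move=> w /= lt.
  have := lt_le_trans lt (sum_split w).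
  have [?|?] := ltP c `|S L w|; first by left; left.
  have [?|?] := ltP c `|S M w|; first by left; right.
  have [?|?] := ltP c `|S N w|; first by right.
  have : 3 * c = 6 * e * (k * q)%:R by rewrite /c; ring.
  lra.
apply: (le_trans (measureU2 _ _ _)) => //; first exact: measurableU.
have -> : 3 * B = B + B + B by lra.
rewrite !EFinD; apply: leeD => //.
apply: (le_trans (measureU2 _ _ _)) => //.
exact: leeD.
Qed.

Lemma pair_deviation (i j : nat) (phi : nat -> E -> E -> E -> R) :
  centered_kernel P Z T phi -> (1 <= i <= T)%N -> (1 <= j <= T)%N ->
  (P [set w | (6 * e * (k * q)%:R + 5 * q%:R <
       `|\sum_(1 <= u < T.+1) phi u (Z i w) (Z j w) (Z u w)|)%R] <=
    (3 * (deviation_bound k b e + 2 * b))%:E)%E.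
Proof.
move=> cphi /andP[i0 iT] /andP[j0 jT]; have [ij|ji] := leqP i j.
  by apply: ordered_pair_deviation => //; rewrite i0.
have [mphi phi1 phi0] := cphi.
apply: (@ordered_pair_deviation j i (fun u x y z => phi u y x z)) => //.
  split=> [u|u x y z|u x y uT]; [|exact: phi1|exact: phi0].
  apply: (measurableT_comp (mphi u) (g := fun z : E * E * E => (z.1.2, z.1.1, z.2))).
  have m1 : measurable_fun setT (fun z : E * E * E => z.1) by exact: measurable_fst.
  apply: measurable_fun_pair; last exact: measurable_snd.
  by apply: measurable_fun_pair; apply: measurableT_comp.
by rewrite j0 ltnW.
Qed.

(** A second use of [markov_average], over all [T^2] pairs, diagonal included: the cost is a factor
    [1 / delta], free of [T]. *)
Lemma average_deviation (phi : nat -> E -> E -> E -> R) (delta : R) :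
  centered_kernel P Z T phi -> (0 < T)%N -> 0 < delta ->
  6 * e * (k * q)%:R + 5 * q%:R <= delta * T%:R ->
  (P [set w | (2 * delta < (T%:R ^+ 2)^-1 * \sum_(1 <= i < T.+1) \sum_(1 <= j < T.+1)
       `|T%:R^-1 * \sum_(1 <= u < T.+1) phi u (Z i w) (Z j w) (Z u w)|)%R] <=
    (3 * (deviation_bound k b e + 2 * b) / delta)%:E)%E.
Proof.
move=> cphi T0 delta0 le_delta; have [mphi phi1 phi0] := cphi.
have [e0 e1] := andP e01.
have TR : 0 < T%:R :> R by rewrite ltr0n.
pose f (ij : 'I_T * 'I_T) w :=
  T%:R^-1 * \sum_(1 <= u < T.+1) phi u (Z ij.1.+1 w) (Z ij.2.+1 w) (Z u w).
pose eta := 3 * (deviation_bound k b e + 2 * b).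
have eta0 : 0 <= eta.
  by apply: mulr_ge0 => //; apply: addr_ge0; [exact: deviation_bound_ge0 (ltW e0)|exact: mulr_ge0].
have mf ij : measurable_fun setT (f ij).
  apply: measurable_funM => //; apply: measurable_sum => u.
  apply: (measurableT_comp (mphi u) (g := fun w => (Z ij.1.+1 w, Z ij.2.+1 w, Z u w))).
  by apply: measurable_fun_pair => //; exact: measurable_fun_pair.
have f1 ij w : `|f ij w| <= 1.
  rewrite normrM gtr0_norm ?invr_gt0// ler_pdivrMl// mulr1.
  apply: (le_trans (ler_norm_sum _ _ _)).
  apply: (@le_trans _ _ (\sum_(1 <= u < T.+1) 1)); first exact: ler_sum.
  by rewrite big_const_nat iter_addr_0 subn1.
have Pf ij : (P [set w | (delta < `|f ij w|)%R] <= eta%:E)%E.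
  have := @pair_deviation ij.1.+1 ij.2.+1 phi cphi (ltn_ord ij.1) (ltn_ord ij.2).
  apply: le_trans.
  apply: le_measure; rewrite ?inE.
  - by apply: measurable_set_gt; exact: measurableT_comp.
  - apply: measurable_set_gt; apply: measurableT_comp => //; apply: measurable_sum => u.
    apply: (measurableT_comp (mphi u) (g := fun w => (Z ij.1.+1 w, Z ij.2.+1 w, Z u w))).
    by apply: measurable_fun_pair => //; exact: measurable_fun_pair.
  move=> w /=; rewrite /f normrM gtr0_norm ?invr_gt0// ltr_pdivlMl// mulrC.
  exact: le_lt_trans.
have := @markov_average _ _ _ P _ f 1 delta eta delta0 eta0 ler01 mf f1 Pf.
rewrite mul1r /eta; apply: le_trans; rewrite le_eqVlt; apply/orP; left; apply/eqP.
have sumE w : \sum_(1 <= i < T.+1) \sum_(1 <= j < T.+1)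
    `|T%:R^-1 * \sum_(1 <= u < T.+1) phi u (Z i w) (Z j w) (Z u w)| =
    \sum_(ij : 'I_T * 'I_T) `|f ij w|.
  transitivity (\sum_(i < T) \sum_(j < T) `|f (i, j) w|).
    rewrite big_add1 /= big_mkord; apply: eq_bigr => i _.
    by rewrite big_add1 /= big_mkord.
  by rewrite pair_bigA; apply: eq_bigr => -[].
congr (P _); apply/seteqP; split=> w /=; rewrite sumE card_prod card_ord natrM -expr2;
  by rewrite ltr_pdivlMl ?exprn_gt0// mulrC.
Qed.

End mixing_row.

(** * Decomposition of the statistic *)

Section decomposition.
Context {R : realType} {A : normedModType R}.
Variables (z : nat -> A) (M T : nat).
Hypothesis T0 : (0 < T)%N.
Hypothesis MT : (M <= T)%N.

Definition mean (T : nat) (F : nat -> R) : R := T%:R^-1 * \sum_(1 <= u < T.+1) F u.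

Let TR : 0 < T%:R :> R. Proof. by rewrite ltr0n. Qed.
Let p : R := M%:R / T%:R.
Let p0 : 0 <= p. Proof. by rewrite divr_ge0. Qed.
Let p1 : p <= 1. Proof. by rewrite ler_pdivrMr// mul1r ler_nat. Qed.

Lemma le_mean (F G : nat -> R) : (forall u, F u <= G u) -> mean T F <= mean T G.
Proof. by move=> FG; rewrite ler_wpM2l ?invr_ge0// ler_sum. Qed.

Lemma ler_norm_mean (F : nat -> R) : `|mean T F| <= mean T (fun u => `|F u|).
Proof. by rewrite normrM gtr0_norm ?invr_gt0// ler_wpM2l ?invr_ge0// ler_norm_sum. Qed.

Lemma meanB (F G : nat -> R) : mean T (fun u => F u - G u) = mean T F - mean T G.
Proof. by rewrite /mean sumrB mulrBr. Qed.

Lemma meanZ (c : R) (F : nat -> R) : mean T (fun u => c * F u) = c * mean T F.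
Proof. by rewrite /mean -mulr_sumr mulrCA. Qed.

Lemma mean_cst (c : R) : mean T (fun=> c) = c.
Proof.
rewrite /mean big_const_nat iter_addr_0 subn1 /= -[c *+ _]mulr_natr mulrCA mulVf ?mulr1//.
by rewrite gt_eqF.
Qed.

Lemma mean_if (F G : nat -> R) : mean T (fun u => if (u <= M)%N then F u else G u) =
  T%:R^-1 * \sum_(1 <= u < M.+1) F u + T%:R^-1 * \sum_(M.+1 <= u < T.+1) G u.
Proof.
rewrite /mean (@big_cat_nat _ _ _ M.+1)//= mulrDr; congr (_ * _ + _ * _).
  by apply: eq_big_nat => u; rewrite ltnS => /andP[_ ->].
by apply: eq_big_nat => u /andP[Mu _]; rewrite leqNgt Mu.
Qed.

Lemma mean_if_cst (a b : R) : mean T (fun u => if (u <= M)%N then a else b) = p * a + (1 - p) * b.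
Proof.
have TN := negbT (gt_eqF TR).
rewrite mean_if !big_const_nat !iter_addr_0 subn1 subSS /=.
rewrite -[a *+ _]mulr_natr -[b *+ _]mulr_natr natrB// /p.
by field.
Qed.

Lemma mean_C1 (x y : A) i j : x = z i -> y = z j ->
  T%:R^-1 * \sum_(1 <= u < M.+1) cball x y (z u) = p * C1 z M i j.
Proof.
move=> -> ->; rewrite /C1 /p mulrA; have [->|M0] := posnP M; first by rewrite big_geq// !mulr0.
by congr (_ * _); field; rewrite !gt_eqF// ltr0n.
Qed.

Lemma mean_C2 (x y : A) i j : x = z i -> y = z j ->
  T%:R^-1 * \sum_(M.+1 <= u < T.+1) cball x y (z u) = (1 - p) * C2 z M T i j.
Proof.
move=> -> ->; rewrite /C2 /p mulrA; have [TM|MT'] := leqP T M.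
  by rewrite big_geq ?ltnS// !mulr0.
have NR : 0 < T%:R - M%:R :> R by rewrite subr_gt0 ltr_nat.
by congr (_ * _); rewrite natrB//; field; rewrite !gt_eqF.
Qed.

Lemma cball01 (x y t : A) : 0 <= cball x y t <= 1.
Proof. by rewrite /cball indicE; case: (_ \in _); rewrite ?lexx ?ler01. Qed.

Lemma C1_01 i j : 0 <= C1 z M i j <= 1.
Proof.
rewrite /C1; apply/andP; split.
  by rewrite mulr_ge0 ?invr_ge0// sumr_ge0// => u _; have /andP[] := cball01 (z i) (z j) (z u).
(* For an empty first sample the inverse of 0 is 0 by convention, and so is [C1]. *)
have [->|M0] := posnP M; first by rewrite invr0 mul0r.
rewrite ler_pdivrMl ?ltr0n// mulr1.
apply: (@le_trans _ _ (\sum_(1 <= u < M.+1) 1)).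
  by apply: ler_sum => u _; have /andP[] := cball01 (z i) (z j) (z u).
by rewrite big_const_nat iter_addr_0 subn1.
Qed.

Lemma C2_01 i j : 0 <= C2 z M T i j <= 1.
Proof.
rewrite /C2; apply/andP; split.
  by rewrite mulr_ge0 ?invr_ge0// sumr_ge0// => u _; have /andP[] := cball01 (z i) (z j) (z u).
have [->|M0] := posnP (T - M); first by rewrite invr0 mul0r.
rewrite ler_pdivrMl ?ltr0n// mulr1.
apply: (@le_trans _ _ (\sum_(M.+1 <= u < T.+1) 1)).
  by apply: ler_sum => u _; have /andP[] := cball01 (z i) (z j) (z u).
by rewrite big_const_nat iter_addr_0 subSS.
Qed.

Variables (F1 F2 : A -> A -> R) (I1 I2 : A -> R) (J1 J2 : R).
Hypothesis F01 : forall x y, (0 <= F1 x y <= 1) && (0 <= F2 x y <= 1).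

(* The weights 1 - p and - p stay bounded even when p tends to 0 or 1, where 1 / p and
   1 / (1 - p) blow up: this is why V / T rather than D is expanded. *)
Definition cball_kernel (p : R) (u : nat) (x y t : A) : R :=
  if (u <= M)%N then (1 - p) * (cball x y t - F1 x y) else - p * (cball x y t - F2 x y).

(** Here the summed observation [t] is the point on the sphere, in [mean_kernel] it is the centre.
    Both keep the three-point shape of [cball_kernel], so that one deviation bound serves all three
    stages. *)
Definition square_kernel (u : nat) (x _ t : A) : R :=
  (F1 x t - F2 x t) ^+ 2 - (if (u <= M)%N then I1 x else I2 x).

Definition mean_kernel (p : R) (u : nat) (_ _ t : A) : R :=
  p * I1 t + (1 - p) * I2 t - (if (u <= M)%N then J1 else J2).

Let err (phi : nat -> A -> A -> A -> R) : R :=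
  (T%:R ^+ 2)^-1 * \sum_(1 <= i < T.+1) \sum_(1 <= j < T.+1)
    `|T%:R^-1 * \sum_(1 <= u < T.+1) phi u (z i) (z j) (z u)|.

Let errE phi : err phi =
  mean T (fun i => mean T (fun j => `|mean T (fun u => phi u (z i) (z j) (z u))|)).
Proof.
by rewrite /err /mean expr2 invfM -mulrA mulr_sumr.
Qed.

(** A deterministic telescoping from [C1], [C2] to [F1], [F2], then to [I1], [I2], then to [J1],
    [J2]. The prefactor [p (1 - p)] is absorbed into the kernel in the first stage and bounded by 1
    in the other two. *)
Lemma V_stat_decomposition :
  `|V_stat z M T / T%:R - p * (1 - p) * (p * J1 + (1 - p) * J2)| <=
  2 * err (cball_kernel p) + err square_kernel + err (mean_kernel p).
Proof.
have TN := negbT (gt_eqF TR).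
pose g x y := (F1 x y - F2 x y) ^+ 2.
have VE : V_stat z M T / T%:R =
    p * (1 - p) * mean T (fun i => mean T (fun j => (C1 z M i j - C2 z M T i j) ^+ 2)).
  rewrite /V_stat /D_stat /mean -mulr_sumr natrB// /p.
  by field.
pose v := p * (1 - p).
have v0 : 0 <= v by rewrite mulr_ge0// subr_ge0.
have v1 : v <= 1 by rewrite mulr_ile1// ?subr_ge0// lerBlDr lerDl.
pose D1 := mean T (fun i => mean T (fun j => (C1 z M i j - C2 z M T i j) ^+ 2)).
pose D2 := mean T (fun i => mean T (fun j => g (z i) (z j))).
pose D3 := mean T (fun i => p * I1 (z i) + (1 - p) * I2 (z i)).
pose D4 := p * J1 + (1 - p) * J2.
have step1 : `|v * D1 - v * D2| <= 2 * err (cball_kernel p).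
  rewrite -mulrBr /D1 /D2 -meanB -meanZ errE -meanZ.
  apply: (le_trans (ler_norm_mean _)); apply: le_mean => i.
  rewrite -meanB -meanZ -meanZ; apply: (le_trans (ler_norm_mean _)); apply: le_mean => j.
  (* The weights [1 - p] and [- p] meet the sample proportions [p] and [1 - p], producing the common
     factor [v]. *)
  have -> : mean T (fun u => cball_kernel p u (z i) (z j) (z u)) =
      v * (C1 z M i j - C2 z M T i j - (F1 (z i) (z j) - F2 (z i) (z j))).
    rewrite /cball_kernel; move: (F1 _ _) (F2 _ _) => f1 f2.
    rewrite mean_if -!mulr_sumr !sumrB !big_const_nat !iter_addr_0 subn1 subSS/=.
    rewrite 2![_^-1 * (_ * _)]mulrCA !mulrBr (mean_C1 erefl erefl) (mean_C2 erefl erefl).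
    rewrite -[f1 *+ _]mulr_natr -[f2 *+ _]mulr_natr natrB// /v.
    have -> : M%:R = p * T%:R :> R by rewrite /p; field.
    by field.
  rewrite /g; have := F01 (z i) (z j) => /andP[/andP[]].
  move: (F1 _ _) (F2 _ _) => f1 f2 ? ? /andP[? ?].
  have /andP[] := C1_01 i j; have /andP[] := C2_01 i j.
  move: (C1 _ _ _ _) (C2 _ _ _ _ _) => c1 c2 ? ? ? ?.
  (* In the factored difference of squares the sum is at most 2 in absolute value, all four
     quantities being in [0, 1]; hence the factor 2. *)
  rewrite subr_sqr mulrA [`|_ * (_ + _)|]normrM mulrC ler_wpM2r//.
  by rewrite ler_norml; apply/andP; split; lra.
have step2 : `|v * D2 - v * D3| <= err square_kernel.
  rewrite -mulrBr normrM (ger0_norm v0) /D2 /D3 -meanB errE.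
  apply: (@le_trans _ _ `|mean T (fun u => mean T (fun j => g (z u) (z j)) -
    (p * I1 (z u) + (1 - p) * I2 (z u)))|); first by rewrite ler_piMl.
  apply: (le_trans (ler_norm_mean _)); apply: le_mean => i.
  by rewrite /square_kernel mean_cst meanB mean_if_cst.
have step3 : `|v * D3 - v * D4| <= err (mean_kernel p).
  rewrite errE /mean_kernel !mean_cst meanB mean_if_cst -/D3 -/D4.
  by rewrite -[v * D3 - _](mulrBr v D3 D4) [`|v * _|]normrM (ger0_norm v0) ler_piMl.
rewrite VE -/v -/D1 -/D4.
have -> : v * D1 - v * D4 = (v * D1 - v * D2) + (v * D2 - v * D3) + (v * D3 - v * D4) by ring.
apply: (le_trans (ler_normD _ _)); apply: lerD => //.
by apply: (le_trans (ler_normD _ _)); exact: lerD.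
Qed.

End decomposition.

(** * Measurability and population quantities *)

Section bounded_integrals.
Context {d d' : measure_display} {R : realType} {W : measurableType d} {E : measurableType d'}.
Variables (P : probability W R) (mu nu : probability E R).

Lemma Rintegral_EFin (f : E -> R) (M : R) : measurable_fun setT f -> (forall x, `|f x| <= M) ->
  ((\int[mu]_x f x)%:E = \int[mu]_x (f x)%:E)%E.
Proof.
move=> mf fM; rewrite /Rintegral fineK//.
exact: integrable_fin_num (bounded_integrable mu mf fM).
Qed.

Lemma Rintegral_01 (f : E -> R) : measurable_fun setT f -> (forall x, 0 <= f x <= 1) ->
  0 <= \int[mu]_x f x <= 1.
Proof.
move=> mf f01; have f1 x : `|f x| <= 1 by have /andP[f0 f1] := f01 x; rewrite ger0_norm.
rewrite -!lee_fin (Rintegral_EFin mf f1); apply/andP; split.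
  by apply: integral_ge0 => x _; rewrite lee_fin; have /andP[] := f01 x.
have <- : (\int[mu]_x (cst 1%E x) = 1)%E.
  by rewrite integral_cst// mul1e; exact: probability_setT.
apply: ge0_le_integral => //.
- by move=> x _; rewrite lee_fin; have /andP[] := f01 x.
- exact/measurable_EFinP.
- by move=> x _; rewrite lee_fin; have /andP[] := f01 x.
Qed.

Lemma integral_law (Z : {mfun W >-> E}) (f : E -> R) : measurable_fun setT f ->
  (forall x, 0 <= f x <= 1) -> (forall B, measurable B -> distribution P Z B = mu B) ->
  (\int[P]_w (f (Z w))%:E = (\int[mu]_x f x)%:E)%E.
Proof.
move=> mf f01 law; have f1 x : `|f x| <= 1 by have /andP[f0 f1] := f01 x; rewrite ger0_norm.
rewrite (Rintegral_EFin mf f1).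
transitivity (\int[distribution P Z]_x (f x)%:E)%E.
  rewrite ge0_integral_distribution//; first exact/measurable_EFinP.
  by move=> x; rewrite lee_fin; have /andP[] := f01 x.
by apply: eq_measure_integral => B mB _; exact: law.
Qed.

Lemma integral_centered (Z : {mfun W >-> E}) (f : E -> R) (c m : R) : measurable_fun setT f ->
  (forall x, 0 <= f x <= 1) -> (forall B, measurable B -> distribution P Z B = mu B) ->
  m = \int[mu]_x f x -> (\int[P]_w (c * (f (Z w) - m))%:E = 0)%E.
Proof.
move=> mf f01 law ->; under eq_integral do rewrite mulrBr addrC.
rewrite (integral_affine (M := 1) (m := \int[mu]_x f x)).
- by rewrite addNr.
- exact: measurableT_comp.
- by move=> w; have /andP[f0 f1] := f01 (Z w); rewrite ger0_norm.
- exact: integral_law.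
Qed.

Lemma measurable_fun_Rintegral d2 (E2 : measurableType d2) (f : E2 * E -> R) :
  measurable_fun setT f -> (forall z, 0 <= f z) ->
  measurable_fun setT (fun x => \int[mu]_y f (x, y)).
Proof.
move=> mf f0; apply: measurableT_comp; first exact: fine_measurable.
apply: (measurable_fun_fubini_tonelli_F (m2 := mu) (EFin \o f)).
  exact/measurable_EFinP.
by move=> z /=; rewrite lee_fin.
Qed.

End bounded_integrals.

Lemma Rintegral_mixture {R : realType} {A : normedModType R} (a : {i01 R})
    (mu nu : probability (borel A) R) (f : borel A -> R) :
  measurable_fun setT f -> (forall x, 0 <= f x <= 1) ->
  \int[mixture a mu nu]_x f x =
  a%:num * \int[mu]_x f x + (1 - a%:num) * \int[nu]_x f x.
Proof.
move=> mf f01; have f1 x : `|f x| <= 1 by have /andP[f0 f1] := f01 x; rewrite ger0_norm.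
have f0 x : 0 <= f x by have /andP[] := f01 x.
have mEf : measurable_fun setT (EFin \o f) by exact/measurable_EFinP.
rewrite /Rintegral /mixture ge0_integral_measure_add//; last by move=> x _; rewrite lee_fin.
rewrite !ge0_integral_mscale//; try by move=> x _; rewrite lee_fin.
by rewrite -!(Rintegral_EFin _ mf f1)/=.
Qed.

Lemma measurable_set_lt d (T : measurableType d) (R : realType) (f : T -> R) (c : R) :
  measurable_fun setT f -> measurable [set x | f x < c].
Proof.
move=> mf; rewrite (_ : [set x | _] = [set x | - c < - f x]).
  by apply: measurable_set_gt; exact: measurableT_comp.
by apply/seteqP; split=> x /=; rewrite ltrN2.
Qed.

Lemma bigcup_countable_measurable d (T : measurableType d) (I : Type) (D : set I) (S : I -> set T) :
  countable D -> (forall i, D i -> measurable (S i)) -> measurable (\bigcup_(i in D) S i).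
Proof.
move=> /countable_injP[f finj] mS.
rewrite (_ : \bigcup_(i in D) S i =
  \bigcup_n (\bigcup_(i in [set i | D i /\ f i = n]) S i)); last first.
  apply/seteqP; split=> [x [i Di Six]|x [n _ [i [Di _] Six]]]; last by exists i.
  by exists (f i) => //; exists i.
apply: bigcup_measurable => n _.
have [[i [Di fin]]|none] := pselect (exists i, D i /\ f i = n).
  rewrite (_ : \bigcup_(i in _) _ = S i); first exact: mS.
  apply/seteqP; split=> [x [j [Dj fjn] Sjx]|x Six]; last by exists i.
  by rewrite (finj i j) ?inE// fin fjn.
rewrite (_ : \bigcup_(i in _) _ = set0); first exact: measurable0.
by apply/seteqP; split=> // x [i [Di fin] _]; apply: none; exists i.
Qed.

(** * Measurability of balls in a separable space *)

Section ball_measurability.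
Context {R : realType} {A : completeNormedModType R}.
Hypothesis sepA : separable A.

Let dist_measurable (a : A) : measurable_fun setT (fun x : borel A => `|x - a| : R).
Proof.
apply: (measurability _ (RGenInftyO.measurableE R)) => _ [_ [c ->] <-].
rewrite setTI; apply: sub_sigma_algebra.
apply: open_comp; last exact: interval_open.
move=> x _; apply: cvg_norm; apply: cvgB; [exact: cvg_id|exact: cvg_cst].
Qed.

(** Measurability is for the product of the Borel sigma-algebras, to which open sets of the product
    topology need not a priori belong. Separability writes [|x - y| < c] as a countable union, over
    a dense set of points [a], of the conditions [|x - a| + |y - a| < c]. *)
Lemma measurable_fun_dist : measurable_fun setT (fun z : borel A * borel A => `|z.1 - z.2| : R).
Proof.
have [D cD dD] := sepA.
apply: (measurability _ (RGenInftyO.measurableE R)) => _ [_ [c ->] <-].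
rewrite setTI.
rewrite [X in measurable X](_ : _ =
  \bigcup_(a in D) [set z : borel A * borel A | `|z.1 - a| + `|z.2 - a| < c]).
  apply: bigcup_countable_measurable => // a _.
  apply: measurable_set_lt; apply: measurable_funD.
  - exact: (measurableT_comp (dist_measurable a) measurable_fst).
  - exact: (measurableT_comp (dist_measurable a) measurable_snd).
apply/seteqP; split=> [[x y] /=|[x y] [a Da] /=]; rewrite in_itv/=; last first.
  apply: le_lt_trans; rewrite -(subrKA a); apply: (le_trans (ler_normD _ _)).
  by rewrite (distrC a).
(* Half the slack suffices: [|x - a| + |y - a| <= 2 |x - a| + |x - y| < c] once [a] is within [del]
   of [x]. *)
move=> xyc; pose del := (c - `|x - y|) / 2.
have del0 : 0 < del by rewrite divr_gt0// subr_gt0.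
have ballx : (ball x del : set A) !=set0 by exists x; exact: ballxx.
have [a [xa Da]] := dD _ ballx (ball_open x del).
exists a => //=; move: xa; rewrite -ball_normE /= => xa.
have : `|y - a| <= `|x - y| + `|x - a|.
  by rewrite (distrC x y) -[y - a](subrKA x) ler_normD.
rewrite /del in xa *; lra.
Qed.

Lemma measurable_ballto (x y : A) : measurable (ballto x y : set (borel A)).
Proof.
rewrite (_ : ballto x y = ~` [set t : borel A | `|x - y| < `|t - x|]).
  by apply: measurableC; exact: measurable_set_gt.
by apply/seteqP; split=> t; rewrite /ballto /closed_ball_ /= (distrC t x) leNgt => /negP.
Qed.

Lemma measurable_fun_cball : measurable_fun setT
  (fun z : borel A * borel A * borel A => cball z.1.1 z.1.2 z.2 : R).
Proof.
have mB : measurable [set z : borel A * borel A * borel A | `|z.1.1 - z.2| <= `|z.1.1 - z.1.2|].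
  have m1 : measurable_fun setT (fun z : borel A * borel A * borel A => `|z.1.1 - z.2| : R).
    apply: (measurableT_comp measurable_fun_dist (g := fun z => (z.1.1, z.2))).
    apply: measurable_fun_pair; last exact: measurable_snd.
    by apply: measurableT_comp; exact: measurable_fst.
  have m2 : measurable_fun setT (fun z : borel A * borel A * borel A => `|z.1.1 - z.1.2| : R).
    exact: (measurableT_comp measurable_fun_dist measurable_fst).
  rewrite (_ : [set z | _] = ~` [set z | 0 < `|z.1.1 - z.2| - `|z.1.1 - z.1.2|]).
    by apply: measurableC; apply: measurable_set_gt; exact: measurable_funB.
  by apply/seteqP; split=> z /=; rewrite subr_gt0 leNgt => /negP.
rewrite [X in measurable_fun _ X](_ : _ = \1_[set z : borel A * borel A * borel A |
    `|z.1.1 - z.2| <= `|z.1.1 - z.1.2|]); first exact: measurable_indic.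
by apply/funext => z; rewrite /cball !indicE.
Qed.

End ball_measurability.

(** * The three errors in one row of the array *)

Section row.
Context {R : realType} {A : completeNormedModType R}.
Hypothesis sepA : separable A.
Variables mu1 mu2 : probability (borel A) R.

Definition ball_mass (mu : probability (borel A) R) (x y : A) : R := fine (mu (ballto x y)).

Definition mass_gap (x y : A) : R := (ball_mass mu1 x y - ball_mass mu2 x y) ^+ 2.

Definition mean_gap (mu : probability (borel A) R) (x : A) : R := \int[mu]_y mass_gap x y.

Definition gap (mu nu : probability (borel A) R) : R := \int[nu]_x mean_gap mu x.

Lemma ball_mass_Rintegral (mu : probability (borel A) R) (x y : A) :
  ball_mass mu x y = \int[mu]_t cball x y t.
Proof.
by rewrite /ball_mass /Rintegral /cball integral_indic ?setIT//; exact: measurable_ballto.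
Qed.

Lemma ball_mass01 (mu : probability (borel A) R) (x y : A) : 0 <= ball_mass mu x y <= 1.
Proof.
rewrite /ball_mass fine_ge0//= -lee_fin fineK ?probability_le1//.
  exact: measurable_ballto.
by apply: fin_num_measure; exact: measurable_ballto.
Qed.

Lemma measurable_ball_mass (mu : probability (borel A) R) :
  measurable_fun setT (fun z : borel A * borel A => ball_mass mu z.1 z.2).
Proof.
under eq_fun do rewrite ball_mass_Rintegral.
apply: (measurable_fun_Rintegral mu (measurable_fun_cball sepA)) => z.
by have /andP[] := cball01 z.1.1 z.1.2 z.2.
Qed.

Lemma measurable_mass_gap :
  measurable_fun setT (fun z : borel A * borel A => mass_gap z.1 z.2).
Proof.
by apply: measurable_funX; apply: measurable_funB; exact: measurable_ball_mass.
Qed.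

Lemma mass_gap01 (x y : A) : 0 <= mass_gap x y <= 1.
Proof.
rewrite /mass_gap sqr_ge0/=.
have /andP[? ?] := ball_mass01 mu1 x y; have /andP[? ?] := ball_mass01 mu2 x y.
rewrite -[_ ^+ 2]ger0_norm ?sqr_ge0// normrX exprn_ile1// ler_norml.
by apply/andP; split; lra.
Qed.

Lemma measurable_mass_gapr (x : A) : measurable_fun setT (fun y : borel A => mass_gap x y).
Proof.
apply: (measurableT_comp (f := fun z : borel A * borel A => mass_gap z.1 z.2)
  (g := fun y : borel A => (x : borel A, y)) measurable_mass_gap).
exact: measurable_fun_pair.
Qed.

Lemma measurable_mean_gap (mu : probability (borel A) R) :
  measurable_fun setT (mean_gap mu : borel A -> R).
Proof.
apply: (measurable_fun_Rintegral mu measurable_mass_gap) => z.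
by have /andP[] := mass_gap01 z.1 z.2.
Qed.

Lemma mean_gap01 (mu : probability (borel A) R) (x : A) : 0 <= mean_gap mu x <= 1.
Proof. by apply: Rintegral_01; [exact: measurable_mass_gapr|exact: mass_gap01]. Qed.

Lemma gap01 (mu nu : probability (borel A) R) : 0 <= gap mu nu <= 1.
Proof. by apply: Rintegral_01; [exact: measurable_mean_gap|exact: mean_gap01]. Qed.

Lemma Rintegral_mixed_mean_gap (p : R) (nu : probability (borel A) R) :
  \int[nu]_x (p * mean_gap mu1 x + (1 - p) * mean_gap mu2 x) =
  p * gap mu1 nu + (1 - p) * gap mu2 nu.
Proof.
have int mu : nu.-integrable setT (EFin \o (mean_gap mu : borel A -> R)).
  apply: (bounded_integrable nu (M := 1) (measurable_mean_gap mu)) => x.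
  by have /andP[? ?] := mean_gap01 mu x; rewrite ger0_norm.
rewrite RintegralD//; last 2 first.
- exact: (integrableZl measurableT p (int mu1)).
- exact: (integrableZl measurableT (1 - p) (int mu2)).
by rewrite !RintegralZl.
Qed.

(** [p (1 - p)] times the ball divergence of weight [p], expanded over the components of both
    mixtures: a polynomial in [p], so its continuity is immediate. *)
Definition limit_at (p : R) : R :=
  p * (1 - p) * (p * (p * gap mu1 mu1 + (1 - p) * gap mu2 mu1) +
    (1 - p) * (p * gap mu1 mu2 + (1 - p) * gap mu2 mu2)).

Context {d : measure_display} {W : measurableType d}.
Variables (P : probability W R) (Z : nat -> {mfun W >-> borel A}).
Variables (M T q k : nat) (b e delta : R).
Hypothesis mixZ : mixing_bound P Z T q b.
Hypothesis b0 : 0 <= b.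
Hypothesis q0 : (0 < q)%N.
Hypothesis k0 : (0 < k)%N.
Hypothesis Tkq : (T <= k * q)%N.
Hypothesis e01 : 0 < e <= 1.
Hypothesis T0 : (0 < T)%N.
Hypothesis MT : (M <= T)%N.
Hypothesis delta0 : 0 < delta.
Hypothesis ledelta : 6 * e * (k * q)%:R + 5 * q%:R <= delta * T%:R.
Hypothesis law1 : forall i, (1 <= i <= M)%N ->
  forall B, measurable B -> distribution P (Z i) B = mu1 B.
Hypothesis law2 : forall i, (M < i <= T)%N ->
  forall B, measurable B -> distribution P (Z i) B = mu2 B.

Let p : R := M%:R / T%:R.
Let p01 : 0 <= p <= 1.
Proof. by rewrite divr_ge0//= ler_pdivrMr ?ltr0n// mul1r ler_nat. Qed.

Let J1 := p * gap mu1 mu1 + (1 - p) * gap mu2 mu1.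
Let J2 := p * gap mu1 mu2 + (1 - p) * gap mu2 mu2.

Let mix01 (x y : R) : 0 <= x <= 1 -> 0 <= y <= 1 -> 0 <= p * x + (1 - p) * y <= 1.
Proof. by have /andP[? ?] := p01; move=> /andP[? ?] /andP[? ?]; apply/andP; split; nra. Qed.

Let dist01 (x y : R) : 0 <= x <= 1 -> 0 <= y <= 1 -> `|x - y| <= 1.
Proof. by move=> /andP[? ?] /andP[? ?]; rewrite ler_norml; apply/andP; split; lra. Qed.

Let m1 : measurable_fun setT (fun z : borel A * borel A * borel A => z.1.1).
Proof. exact: (measurableT_comp measurable_fst measurable_fst). Qed.

Let m2 : measurable_fun setT (fun z : borel A * borel A * borel A => z.1.2).
Proof. exact: (measurableT_comp measurable_snd measurable_fst). Qed.

Lemma centered_cball_kernel :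
  centered_kernel P Z T (cball_kernel M (ball_mass mu1) (ball_mass mu2) p).
Proof.
have /andP[p0 p1] := p01.
split.
- move=> u; rewrite /cball_kernel.
  have mb mu : measurable_fun setT
      (fun z : borel A * borel A * borel A => ball_mass mu z.1.1 z.1.2).
    exact: (measurableT_comp (measurable_ball_mass mu) measurable_fst).
  case: (u <= M)%N; apply: measurable_funM => //; apply: measurable_funB => //.
  + exact: measurable_fun_cball.
  + exact: measurable_fun_cball.
- move=> u x y t; rewrite /cball_kernel; case: ifP => _; rewrite normrM mulr_ile1//.
  + by rewrite ger0_norm ?subr_ge0// lerBlDr lerDl.
  + by apply: dist01; [exact: cball01|exact: ball_mass01].
  + by rewrite normrN ger0_norm.
  + by apply: dist01; [exact: cball01|exact: ball_mass01].
- move=> u x y uT; rewrite /cball_kernel.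
  have mc : measurable_fun setT (cball x y : borel A -> R).
    apply: (measurableT_comp (measurable_fun_cball sepA) (g := fun t => (x, y, t))).
    exact: measurable_fun_pair.
  have [uM|Mu] := leqP u M.
    apply: (integral_centered (mu := mu1)) => //; [exact: cball01|apply: law1; lia|].
    exact: ball_mass_Rintegral.
  apply: (integral_centered (mu := mu2)) => //; [exact: cball01|apply: law2; lia|].
  exact: ball_mass_Rintegral.
Qed.

Lemma centered_square_kernel : centered_kernel P Z T
  (square_kernel M (ball_mass mu1) (ball_mass mu2) (mean_gap mu1) (mean_gap mu2)).
Proof.
split.
- move=> u; rewrite /square_kernel; apply: measurable_funB.
    apply: (measurableT_comp measurable_mass_gap (g := fun z => (z.1.1, z.2))).
    by apply: measurable_fun_pair => //; exact: measurable_snd.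
  by case: (u <= M)%N; exact: (measurableT_comp (measurable_mean_gap _) m1).
- move=> u x y t; rewrite /square_kernel; apply: dist01; first exact: mass_gap01.
  by case: ifP => _; exact: mean_gap01.
- move=> u x y uT; rewrite /square_kernel.
  under eq_integral do rewrite -[X in X%:E]mul1r.
  have [uM|Mu] := leqP u M.
    apply: (integral_centered (mu := mu1) (f := mass_gap x)) => //.
    + exact: measurable_mass_gapr.
    + exact: mass_gap01.
    + by apply: law1; lia.
  apply: (integral_centered (mu := mu2) (f := mass_gap x)) => //.
  + exact: measurable_mass_gapr.
  + exact: mass_gap01.
  + by apply: law2; lia.
Qed.

Lemma centered_mean_kernel : centered_kernel P Z T
  (mean_kernel M (mean_gap mu1) (mean_gap mu2) J1 J2 p).
Proof.
pose G t := p * mean_gap mu1 t + (1 - p) * mean_gap mu2 t.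
have mG : measurable_fun setT (G : borel A -> R).
  by apply: measurable_funD; apply: measurable_funM => //; exact: measurable_mean_gap.
have G01 t : 0 <= G t <= 1 by apply: mix01; exact: mean_gap01.
split.
- by move=> u; rewrite /mean_kernel; apply: measurable_funB => //;
    exact: (measurableT_comp mG measurable_snd).
- move=> u x y t; rewrite /mean_kernel; apply: dist01; first exact: G01.
  by case: ifP => _; apply: mix01; exact: gap01.
- move=> u x y uT; rewrite /mean_kernel.
  under eq_integral do rewrite -[X in X%:E]mul1r.
  have [uM|Mu] := leqP u M.
    apply: (integral_centered (mu := mu1) (f := G)) => //; first by apply: law1; lia.
    by rewrite Rintegral_mixed_mean_gap.
  apply: (integral_centered (mu := mu2) (f := G)) => //; first by apply: law2; lia.
  by rewrite Rintegral_mixed_mean_gap.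
Qed.

Let err (phi : nat -> A -> A -> A -> R) w : R :=
  (T%:R ^+ 2)^-1 * \sum_(1 <= i < T.+1) \sum_(1 <= j < T.+1)
    `|T%:R^-1 * \sum_(1 <= u < T.+1) phi u (Z i w) (Z j w) (Z u w)|.

Let measurable_err phi : centered_kernel P Z T phi -> measurable [set w | 2 * delta < err phi w].
Proof.
move=> [mphi _ _]; apply: measurable_set_gt; apply: measurable_funM => //.
apply: measurable_sum => i; apply: measurable_sum => j.
apply: measurableT_comp => //; apply: measurable_funM => //; apply: measurable_sum => u.
apply: (measurableT_comp (mphi u) (g := fun w => (Z i w, Z j w, Z u w))).
by apply: measurable_fun_pair => //; exact: measurable_fun_pair.
Qed.

(** [N] is the union of three events where an error average exceeds [2 delta], which triples the
    constant 3 of [average_deviation]. Outside [N] the decomposition gives [2 * 2 + 2 + 2 = 8] times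
    [delta]. *)
Lemma row_deviation : exists N : set W,
  [/\ measurable N, (P N <= (9 * (deviation_bound k b e + 2 * b) / delta)%:E)%E &
      forall w, ~ N w ->
        `|V_stat (fun i => Z i w : A) M T / T%:R - limit_at p| <= 8 * delta].
Proof.
have c1 := centered_cball_kernel; have c2 := centered_square_kernel.
have c3 := centered_mean_kernel.
exists ([set w | 2 * delta < err (cball_kernel M (ball_mass mu1) (ball_mass mu2) p) w] `|`
  [set w | 2 * delta < err (square_kernel M (ball_mass mu1) (ball_mass mu2)
    (mean_gap mu1) (mean_gap mu2)) w] `|`
  [set w | 2 * delta < err (mean_kernel M (mean_gap mu1) (mean_gap mu2) J1 J2 p) w]).
have E1 := measurable_err c1; have E2 := measurable_err c2; have E3 := measurable_err c3.
split.
- by apply: measurableU => //; exact: measurableU.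
- have A1 := average_deviation mixZ b0 q0 k0 Tkq e01 c1 T0 delta0 ledelta.
  have A2 := average_deviation mixZ b0 q0 k0 Tkq e01 c2 T0 delta0 ledelta.
  have A3 := average_deviation mixZ b0 q0 k0 Tkq e01 c3 T0 delta0 ledelta.
  apply: (le_trans (measureU2 _ _ _)) => //; first exact: measurableU.
  set B := 3 * (deviation_bound k b e + 2 * b) / delta in A1 A2 A3.
  rewrite [X in X%:E](_ : _ = B + B + B); last by rewrite /B; field; rewrite gt_eqF.
  rewrite !EFinD; apply: leeD => //.
  by apply: (le_trans (measureU2 _ _ _)) => //; exact: leeD.
- move=> w nN.
  have := @V_stat_decomposition _ _ (fun i => Z i w : A) M T T0 MT _ _ (mean_gap mu1)
    (mean_gap mu2) J1 J2
    (fun x y => introT andP (conj (ball_mass01 mu1 x y) (ball_mass01 mu2 x y))).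
  rewrite -/p => /le_trans; apply.
  have n1 : err (cball_kernel M (ball_mass mu1) (ball_mass mu2) p) w <= 2 * delta.
    by rewrite leNgt; apply/negP => h; apply: nN; left; left.
  have n2 : err (square_kernel M (ball_mass mu1) (ball_mass mu2) (mean_gap mu1) (mean_gap mu2)) w
      <= 2 * delta.
    by rewrite leNgt; apply/negP => h; apply: nN; left; right.
  have n3 : err (mean_kernel M (mean_gap mu1) (mean_gap mu2) J1 J2 p) w <= 2 * delta.
    by rewrite leNgt; apply/negP => h; apply: nN; right.
  rewrite /err in n1 n2 n3; lra.
Qed.

End row.

(** * Rates and almost sure convergence *)

Section rates.
Context {R : realType}.

(** Discrete comparison of the sum of [x^(-1-s)] with its integral. As [n^(-s) = (n+1)^(-s) expR (s
    (ln (n+1) - ln n))], it follows from [1 + t <= expR t] and [ln (n+1) - ln n >= 1 / (n+1)]. *)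
Lemma powR_telescope (s : R) (n : nat) : 0 < s -> (0 < n)%N ->
  n.+1%:R `^ (- 1 - s) <= s^-1 * (n%:R `^ (- s) - n.+1%:R `^ (- s)).
Proof.
move=> s0 n0; set x := n%:R; set y := n.+1%:R.
have x0 : 0 < x by rewrite ltr0n.
have y0 : 0 < y by rewrite ltr0n.
have yx : y = x + 1 by rewrite /y /x natr1.
have -> : y `^ (- 1 - s) = y^-1 * y `^ (- s).
  by rewrite powRD ?(gt_eqF y0) ?implybT// powR_inv1// ltW.
have -> : x `^ (- s) = y `^ (- s) * expR (s * (ln y - ln x)).
  by rewrite /powR !gt_eqF// -expRD; congr expR; ring.
have : 1 + s * (ln y - ln x) <= expR (s * (ln y - ln x)) by exact: expR_ge1Dx.
have lnyx : y^-1 <= ln y - ln x.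
  have -> : ln x = ln y + ln (1 + - y^-1).
    rewrite -lnM ?posrE//; last by rewrite subr_gt0 invf_lt1// yx ltrDr.
    by congr ln; rewrite mulrDr mulr1 mulrN mulfV ?gt_eqF// yx addrK.
  have : - 1 < - y^-1 by rewrite ltrN2 invf_lt1// yx ltrDr.
  by move=> /le_ln1Dx; rewrite opprD addrA subrr add0r lerNr.
have p0 := powR_gt0 (- s) y0; set z := y `^ (- s) in p0 *.
set u := expR _; move: (ln y - ln x) lnyx => l lnyx le_u.
rewrite ler_pdivlMl// mulrA -[X in _ <= _ - X]mulr1 -mulrBr mulrC ler_pM2l// lerBrDl.
by apply: le_trans le_u; rewrite lerD2l ler_pM2l.
Qed.

Lemma powR_ge_eventually (a B : R) : 0 < a -> 0 <= B ->
  exists n0 : nat, forall n, (n0 <= n)%N -> B <= n%:R `^ a.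
Proof.
move=> a0 B0; exists (Num.truncn (B `^ a^-1)).+1 => n nB.
have Bn : B `^ a^-1 <= n%:R.
  have /andP[_ /ltW/le_trans->//] := truncn_itv (powR_ge0 B a^-1).
  by rewrite ler_nat.
have := ge0_ler_powR (ltW a0) _ _ Bn; rewrite -powRrM mulVf ?gt_eqF// powRr1//.
by apply; rewrite nnegrE ?powR_ge0.
Qed.

Variable r : R.
Hypothesis r0 : 0 < r.

(* Progressions of about T^s terms and gap about T^(1-s): this s makes k * q^(-1-r) of order
   T^(-1-r/2), which is summable. *)
Definition exponent : R := r / (2 * (2 + r)).
Definition blocks (T : nat) : nat := (Num.truncn (T%:R `^ exponent)).+1.
Definition spacing (T : nat) : nat := (T %/ blocks T).+1.

Let s0 : 0 < exponent.
Proof. by rewrite divr_gt0// mulr_gt0// addr_gt0. Qed.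

Let s1 : exponent < 1.
Proof.
have r2 : 0 < 2 * (2 + r) by rewrite mulr_gt0// addr_gt0.
by have rr := r0; rewrite /exponent ltr_pdivrMr// mul1r; lra.
Qed.

Lemma leq_blocks_spacing T : (T <= blocks T * spacing T)%N.
Proof. by rewrite mulnC ltnW// ltn_ceil. Qed.

Lemma blocks_spacing_leq T : (blocks T * spacing T <= T + blocks T)%N.
Proof. by rewrite mulnS addnC leq_add2r mulnC leq_trunc_div. Qed.

Section fixed_size.
Variable T : nat.
Hypothesis T0 : (0 < T)%N.

Let TR : 0 < T%:R :> R. Proof. by rewrite ltr0n. Qed.

Let x := T%:R `^ exponent : R.
Let y := T%:R `^ (1 - exponent) : R.

Let x1 : 1 <= x.
Proof.
have T1 : 1 <= T%:R :> R by rewrite ler1n.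
by have := ler_powR T1 (ltW s0); rewrite powRr0.
Qed.

Let y0 : 0 < y. Proof. exact: powR_gt0. Qed.

Let xy : T%:R = x * y.
Proof. by rewrite /x /y -powRD ?subrKC ?powRr1 ?gt_eqF ?implybT// ltW. Qed.

Lemma blocks_ge : x <= (blocks T)%:R.
Proof. by have /andP[_ /ltW] := truncn_itv (powR_ge0 T%:R exponent). Qed.

Lemma blocks_le : (blocks T)%:R <= 2 * x.
Proof.
have /andP[tx _] := truncn_itv (powR_ge0 T%:R exponent).
by rewrite /blocks -natr1; move: tx x1; rewrite -/x; lra.
Qed.

Lemma spacing_ge : y / 2 <= (spacing T)%:R.
Proof.
have k0 : 0 < (blocks T)%:R :> R by rewrite ltr0n.
have : T%:R <= (blocks T)%:R * (spacing T)%:R :> R.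
  by rewrite -natrM ler_nat leq_blocks_spacing.
have := blocks_le; rewrite xy => k2x Tkq.
have q0 : 0 < (spacing T)%:R :> R by rewrite ltr0n.
have : x * y <= 2 * x * (spacing T)%:R by apply: (le_trans Tkq); rewrite ler_pM2r.
have -> : 2 * x * (spacing T)%:R = x * (2 * (spacing T)%:R) by ring.
by rewrite ler_pM2l ?(lt_le_trans ltr01 x1)// ler_pdivrMr// mulrC.
Qed.

Lemma spacing_le : (spacing T)%:R <= y + 1.
Proof.
rewrite /spacing -natr1 lerD2r.
have k0 : 0 < (blocks T)%:R :> R by rewrite ltr0n.
have : (T %/ blocks T)%:R * (blocks T)%:R <= T%:R :> R by rewrite -natrM ler_nat leq_trunc_div.
rewrite xy => le_xy; have kx := blocks_ge.
have d0 : 0 <= (T %/ blocks T)%:R :> R by [].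
have x0 : 0 < x := lt_le_trans ltr01 x1.
have : (T %/ blocks T)%:R * x <= x * y by apply: le_trans le_xy; rewrite ler_wpM2l.
by rewrite mulrC ler_pM2l.
Qed.

(** With [k], [q] the numbers of blocks and spacing, [k q <= T + k <= 2 T] because
    [k <= 2 x <= x y = T], so the first term is at most [delta T / 2]. The second is at most
    [5 (y + 1) <= 10 y <= delta x y / 2], by [20 <= delta x]. *)
Lemma threshold_le (delta : R) : 0 < delta -> 2 <= y -> 20 / delta <= x ->
  6 * (delta / 24) * (blocks T * spacing T)%:R + 5 * (spacing T)%:R <= delta * T%:R.
Proof.
move=> d0 y2 xd.
have : (blocks T * spacing T)%:R <= T%:R + (blocks T)%:R :> R.
  by rewrite -natrD ler_nat blocks_spacing_leq.
have := blocks_le; have := spacing_le; rewrite xy.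
move: (blocks T)%:R (spacing T)%:R (blocks T * spacing T)%:R => k q kq q1 k2 kq1.
have dx : 20 <= delta * x by move: xd; rewrite ler_pdivrMr// mulrC.
have x0 : 0 < x := lt_le_trans ltr01 x1.
have xy2 : 2 * x <= x * y by rewrite mulrC ler_pM2l.
have h1 : delta * kq <= delta * (2 * (x * y)) by rewrite ler_pM2l//; lra.
have h2 : 20 * y <= delta * x * y by rewrite ler_pM2r.
lra.
Qed.

Lemma spacing_rate :
  (blocks T)%:R * (spacing T)%:R `^ (- 1 - r) <= 2 * 2 `^ (1 + r) * T%:R `^ (- 1 - r / 2).
Proof.
have k0 : 0 < (blocks T)%:R :> R by rewrite ltr0n.
have q0 : 0 < (spacing T)%:R :> R by rewrite ltr0n.
have x0 : 0 < x by exact: powR_gt0.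
have rr := r0; have r1 : 0 <= 1 + r by lra.
have -> : - 1 - r = - (1 + r) by ring.
have le1 : (spacing T)%:R `^ (- (1 + r)) <= 2 `^ (1 + r) * y `^ (- (1 + r)).
  rewrite !powRN -[2 `^ _]invrK -invfM lef_pV2 ?posrE ?mulr_gt0 ?invr_gt0 ?powR_gt0//.
  have -> : (2 `^ (1 + r))^-1 * y `^ (1 + r) = (y / 2) `^ (1 + r).
    have half : (2^-1 : R) `^ (1 + r) = (2 `^ (1 + r))^-1.
      by rewrite -[2^-1]powR_inv1// -powRrM mulN1r powRN.
    by rewrite powRM ?half 1?mulrC// ltW.
  by apply: ge0_ler_powR; rewrite ?nnegrE ?divr_ge0 ?(ltW y0)// spacing_ge.
apply: (@le_trans _ _ (2 * x * (2 `^ (1 + r) * y `^ (- (1 + r))))).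
  by apply: ler_pM => //; exact: blocks_le.
rewrite -!mulrA ler_pM2l// mulrCA ler_pM2l ?powR_gt0//.
rewrite /y -powRrM -powRD ?(gt_eqF TR) ?implybT//.
rewrite le_eqVlt; apply/orP; left; apply/eqP; congr (_ `^ _).
(* With [s] the exponent, [s (2 + r) = r / 2], hence [s - (1 - s) (1 + r) = - 1 - r / 2]. *)
by rewrite /exponent; field; lra.
Qed.

(** The exponential of a power of [T] beats every power: [t <= expR t] at [t = c x / m], raised to
    the power [m], gives [(c x / m)^m <= expR (c x)], and [m] is chosen so that
    [x^m = T^(1 + r/2)]. *)
Lemma exp_rate (c : R) : 0 < c ->
  expR (- (c * (blocks T)%:R)) <=
  ((c / ((1 + r / 2) / exponent)) `^ ((1 + r / 2) / exponent))^-1 * T%:R `^ (- 1 - r / 2).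
Proof.
move=> c0; set m := (1 + r / 2) / exponent.
have m0 : 0 < m by have rr := r0; rewrite divr_gt0//; lra.
have x0 : 0 < x by exact: powR_gt0.
have cm0 : 0 < c / m by rewrite divr_gt0.
apply: (@le_trans _ _ (expR (- (c * x)))).
  by rewrite ler_expR lerN2 ler_pM2l// blocks_ge.
rewrite expRN (_ : - 1 - r / 2 = - (1 + r / 2)); last by ring.
rewrite powRN -invfM lef_pV2 ?posrE ?expR_gt0 ?mulr_gt0 ?powR_gt0//.
have -> : T%:R `^ (1 + r / 2) = x `^ m.
  by rewrite /x -powRrM /m mulrCA mulfV ?mulr1// gt_eqF.
rewrite -powRM ?(ltW cm0) ?(ltW x0)//.
have -> : expR (c * x) = expR (c / m * x) `^ m.
  by rewrite -expRM; congr expR; field; rewrite gt_eqF.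
apply: (ge0_ler_powR (ltW m0)); rewrite ?nnegrE ?expR_ge0//.
  exact: mulr_ge0 (ltW cm0) (ltW x0).
by have := expR_ge1Dx (c / m * x); lra.
Qed.

End fixed_size.

Lemma rate (C e delta : R) : 0 <= C -> 0 < e -> 0 < delta ->
  exists2 K : R, 0 <= K & forall T, (0 < T)%N ->
    9 * (deviation_bound (blocks T) (C * (spacing T)%:R `^ (- 1 - r)) e +
      2 * (C * (spacing T)%:R `^ (- 1 - r))) / delta <= K * T%:R `^ (- 1 - r / 2).
Proof.
move=> C0 e0 d0.
pose K1 := C * (2 * 2 `^ (1 + r)).
pose c := e ^+ 2 / 8.
have c0 : 0 < c by rewrite divr_gt0// exprn_gt0.
pose K2 := ((c / ((1 + r / 2) / exponent)) `^ ((1 + r / 2) / exponent))^-1.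
have K10 : 0 <= K1 by rewrite !mulr_ge0// powR_ge0.
have K20 : 0 <= K2 by rewrite invr_ge0 powR_ge0.
exists (9 * (2 * (K1 + K2) / e + 2 * K1) / delta).
  by rewrite divr_ge0 ?(ltW d0)// mulr_ge0// addr_ge0 ?mulr_ge0 ?invr_ge0 ?addr_ge0// ltW.
move=> T T0; rewrite /deviation_bound.
have h1 := ler_wpM2l C0 (spacing_rate T0); have h2 := exp_rate T0 c0.
rewrite -/K2 in h2; set X := T%:R `^ (- 1 - r / 2) in h1 h2 *.
set b := C * _; have b0 : 0 <= b by rewrite mulr_ge0// powR_ge0.
have k1 : 1 <= (blocks T)%:R :> R by rewrite ler1n.
have h3 : (blocks T)%:R * b <= K1 * X by rewrite /b /K1 mulrCA -mulrA.
(* As there is at least one block, the lone [b] inherits the rate of the product. *)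
have h4 : b <= K1 * X by apply: le_trans h3; rewrite ler_peMl.
rewrite -/c; set E := expR _ in h2 *.
have hd : 2 * ((blocks T)%:R * b + E) / e <= 2 * (K1 + K2) / e * X.
  rewrite [leRHS]mulrAC ler_pM2r ?invr_gt0// -[leRHS]mulrA ler_pM2l// [leRHS]mulrDl.
  exact: lerD.
rewrite [leRHS]mulrAC ler_pM2r ?invr_gt0// -[leRHS]mulrA ler_pM2l// [leRHS]mulrDl.
by apply: lerD => //; rewrite -mulrA ler_pM2l.
Qed.

End rates.

(** * Borel-Cantelli *)

(** Telescoping bounds the partial sums of the probabilities by [K / s]. The comparison at [n + 1]
    requires [n >= 1], so it starts at [T = 2]; hence the two empty sets. *)
Lemma ae_eventually_notin d (W : measurableType d) (R : realType) (P : probability W R)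
    (N : nat -> set W) (K s : R) : 0 < s -> 0 <= K -> (forall T, measurable (N T)) ->
  N 0%N = set0 -> N 1%N = set0 ->
  (forall T, (1 < T)%N -> (P (N T) <= (K * T%:R `^ (- 1 - s))%:E)%E) ->
  {ae P, forall w, exists T0 : nat, forall T, (T0 <= T)%N -> ~ N T w}.
Proof.
move=> s0 K0 mN N0 N1 PN.
have partial n : (0 < n)%N ->
    (\sum_(0 <= T < n.+1) P (N T) <= (K / s * (1 - n%:R `^ (- s)))%:E)%E.
  elim: n => // n IHn _; rewrite big_nat_recr//=.
  have [->|n0] := posnP n.
    by rewrite big_nat1 N0 N1 !measure0 adde0 powR1 subrr mulr0.
  have -> : K / s * (1 - n.+1%:R `^ (- s)) = K / s * (1 - n%:R `^ (- s)) +
      K * (s^-1 * (n%:R `^ (- s) - n.+1%:R `^ (- s))) by ring.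
  rewrite EFinD; apply: leeD; first exact: IHn.
  by apply: (le_trans (PN _ _)) => //; rewrite lee_fin ler_wpM2l// powR_telescope.
have lims0 : P (lim_sup_set N) = 0%E.
  apply: lim_sup_set_cvg0 => //; apply: (@le_lt_trans _ _ (K / s)%:E); last exact: ltry.
  apply: lime_le; first exact: is_cvg_nneseries.
  exists 2%N => // -[|[|n]] // _ /=.
  apply: (le_trans (partial n.+1 isT)); rewrite lee_fin.
  apply: ler_piMr; first by rewrite divr_ge0// ltW.
  by rewrite lerBlDr lerDl powR_ge0.
exists (lim_sup_set N); split => //.
  apply: bigcap_measurable => // k _; exact: bigcup_measurable.
move=> w /= nev n _; apply: contrapT => nw; apply: nev; exists n => T nT NT.
by apply: nw; exists T.
Qed.

(** Borel-Cantelli is applied for each [delta = 1 / (m + 1)]; the countably many exceptional null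
    sets are then united. *)
Lemma ae_cvg0 d (W : measurableType d) (R : realType) (P : probability W R)
    (F : nat -> W -> R) (s : R) : 0 < s ->
  (forall delta : R, 0 < delta <= 1 -> exists K T0, 0 <= K /\ forall T, (T0 <= T)%N ->
    exists N : set W, [/\ measurable N, (P N <= (K * T%:R `^ (- 1 - s))%:E)%E &
      forall w, ~ N w -> `|F T w| <= 8 * delta]) ->
  {ae P, forall w, F T w @[T --> \oo] --> 0}.
Proof.
move=> s0 devF.
have ae_delta (m : nat) : {ae P, forall w, exists T0 : nat, forall T, (T0 <= T)%N ->
    `|F T w| <= 8 * m.+1%:R^-1}.
  have m01 : 0 < (m.+1%:R^-1 : R) <= 1 by rewrite invr_gt0 ltr0n/= invf_le1 ?ler1n ?ltr0n.
  have [K [T0 [K0 dev]]] := devF _ m01.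
  (* Below [T0] no bound is available, so [N] is taken empty there; the maximum with 2 also empties
     the sets at 0 and 1. *)
  have ex T : exists N : set W, [/\ measurable N, (T < maxn T0 2)%N -> N = set0,
      (P N <= (K * T%:R `^ (- 1 - s))%:E)%E &
      (maxn T0 2 <= T)%N -> forall w, ~ N w -> `|F T w| <= 8 * m.+1%:R^-1].
    have [TT0|T0T] := ltnP T (maxn T0 2).
      exists set0; split => //.
      by rewrite measure0 lee_fin mulr_ge0// powR_ge0.
    have [|N [mN PN FN]] := dev T; first by move: T0T; rewrite geq_max => /andP[].
    by exists N; split => // TT0; move: T0T; rewrite leqNgt TT0.
  have [N NP] := choice ex.
  have : {ae P, forall w, exists T1 : nat, forall T, (T1 <= T)%N -> ~ N T w}.
    apply: (ae_eventually_notin s0 K0) => [T| | |T _].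
    - by have [] := NP T.
    - by have [_ ->] := NP 0%N; rewrite // leq_max orbT.
    - by have [_ ->] := NP 1%N; rewrite // leq_max orbT.
    - by have [] := NP T.
  apply: filterS => w [T1 NT1]; exists (maxn T1 (maxn T0 2)) => T.
  rewrite geq_max => /andP[T1T T2T].
  by have [_ _ _ FN] := NP T; apply: FN => //; exact: NT1.
have := ae_foralln ae_delta; apply: filterS => w Fw.
apply/cvgr0Pnorm_le => eps eps0.
have [m meps] : exists m : nat, 8 * m.+1%:R^-1 <= eps.
  exists (Num.truncn (8 / eps)).
  have /andP[_ /ltW] := truncn_itv (ltW (divr_gt0 (ltr0n _ 8) eps0)).
  by rewrite ler_pdivrMr// ler_pdivrMr ?ltr0n// mulrC.
have [T0 FT0] := Fw m; exists T0 => // T /= T0T.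
exact: le_trans (FT0 T T0T) meps.
Qed.

(** * Identification of the limit and conclusion *)

Section limit.
Context {R : realType} {A : completeNormedModType R}.
Hypothesis sepA : separable A.
Variables mu1 mu2 : probability (borel A) R.

Lemma V_limitE (a : {i01 R}) : V_limit a mu1 mu2 = limit_at mu1 mu2 a%:num.
Proof.
have a0 : 0 <= a%:num :> R by [].
have a1 : a%:num <= 1 :> R by [].
rewrite /V_limit /limit_at /ball_divergence; congr (_ * _).
have inner u : \int[mixture a mu1 mu2]_v
      (fine (mu1 (ballto u v)) - fine (mu2 (ballto u v))) ^+ 2 =
    a%:num * mean_gap mu1 mu2 mu1 u + (1 - a%:num) * mean_gap mu1 mu2 mu2 u.
  apply: (Rintegral_mixture a mu1 mu2 (f := mass_gap mu1 mu2 u)).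
    exact: measurable_mass_gapr.
  exact: mass_gap01.
under eq_Rintegral do rewrite inner.
rewrite Rintegral_mixture.
- by rewrite !Rintegral_mixed_mean_gap.
- by apply: measurable_funD; apply: measurable_funM => //; exact: measurable_mean_gap.
- move=> x; have /andP[? ?] := mean_gap01 sepA mu1 mu2 mu1 x.
  have /andP[? ?] := mean_gap01 sepA mu1 mu2 mu2 x.
  by apply/andP; split; nra.
Qed.

Lemma cvg_limit_at (p : nat -> R) (a : R) : p n @[n --> \oo] --> a ->
  limit_at mu1 mu2 (p n) @[n --> \oo] --> limit_at mu1 mu2 a.
Proof.
move=> pa.
have qa : 1 - p n @[n --> \oo] --> 1 - a by apply: cvgB => //; exact: cvg_cst.
have lin (x y : R) : p n * x + (1 - p n) * y @[n --> \oo] --> a * x + (1 - a) * y.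
  by apply: cvgD; apply: cvgM => //; exact: cvg_cst.
rewrite /limit_at; apply: cvgM; first exact: cvgM.
by apply: cvgD; apply: cvgM.
Qed.

End limit.

(** [fine] sends an infinite coefficient to 0, so the O-bound alone says nothing about it.
    Convergence to 0 makes the coefficients finite from some lag on, and there [fine] loses
    nothing. *)
Lemma beta_array_bound d d' (W : measurableType d) (E : measurableType d') (R : realType)
    (P : probability W R) (Z : nat -> nat -> W -> E) (r : R) :
  absolutely_regular P Z ->
  (fun l : nat => fine (beta_array P Z l) : R^o) =O_\oo
    (fun l : nat => l%:R `^ (- 1 - r) : R^o) ->
  exists C l0, 0 <= C /\
    forall l, (l0 <= l)%N -> (beta_array P Z l <= (C * l%:R `^ (- 1 - r))%:E)%E.
Proof.
move=> /fine_cvgP[[l1 _ fin] _] /eqOP[C [_ bigO]].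
have CC : C < `|C| + 1 by rewrite ltr_pwDr// ler_norm.
have [l2 _ bound] := bigO _ CC.
exists (`|C| + 1), (maxn l1 l2); split; first by rewrite addr_ge0.
move=> l; rewrite geq_max => /andP[l1l l2l].
rewrite -(fineK (fin l l1l)) lee_fin.
apply: (le_trans (ler_norm _)); apply: (le_trans (bound l l2l)).
by rewrite [X in _ * X <= _]ger0_norm ?powR_ge0.
Qed.

Lemma mixing_bound_array d d' (W : measurableType d) (E : measurableType d') (R : realType)
    (P : probability W R) (Z : nat -> nat -> {mfun W >-> E}) (T q : nat) (b : R) :
  (beta_array P Z q <= b%:E)%E -> mixing_bound P (Z T) T q b.
Proof.
move=> arrayb n; apply: le_trans arrayb.
apply: (@le_trans _ _ (beta_seq P (Z T) T q)).
  by apply: ereal_sup_ubound; exists n.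
by apply: ereal_sup_ubound; exists T.
Qed.

Theorem theorem2p4p1 (R : realType) (A : completeNormedModType R)
    (sepA : separable A)
    (d : measure_display) (W : measurableType d) (P : probability W R)
    (mu1 mu2 : probability (borel A) R)
    (M : nat -> nat) (Z : nat -> nat -> {RV P >-> borel A})
    (r : R) (alpha1 : {i01 R}) (r0 : 0 < r)
    (regZ : absolutely_regular P Z)
    (betaZ : (fun l : nat => fine (beta_array P Z l) : R^o) =O_\oo
             (fun l : nat => l%:R `^ (- 1 - r) : R^o))
    (MleT : forall T, (M T <= T)%N)
    (stat1 : forall T, ergodic_stationary P [set i | (1 <= i <= M T)%N] (Z T))
    (stat2 : forall T, ergodic_stationary P [set i | (M T < i <= T)%N] (Z T))
    (law1 : forall T i, (1 <= i <= M T)%N ->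
      forall B, measurable B -> distribution P (Z T i) B = mu1 B)
    (law2 : forall T i, (M T < i <= T)%N ->
      forall B, measurable B -> distribution P (Z T i) B = mu2 B)
    (Moo : M T @[T --> \oo] --> \oo)
    (MTalpha : (M T)%:R / T%:R @[T --> \oo] --> alpha1%:num) :
  {ae P, forall w : W,
    V_stat (fun i => Z T i w : A) (M T) T / T%:R @[T --> \oo]
      --> V_limit alpha1 mu1 mu2}.
Proof.
have [C [l0 [C0 arrayC]]] := beta_array_bound regZ betaZ.
pose p T : R := (M T)%:R / T%:R.
pose V T w := V_stat (fun i => Z T i w : A) (M T) T / T%:R.
have s0 : 0 < exponent r by rewrite /exponent divr_gt0// mulr_gt0// addr_gt0.
have s1 : 0 < 1 - exponent r.
  have r2 : 0 < 2 * (2 + r) by rewrite mulr_gt0// addr_gt0.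
  by rewrite subr_gt0 /exponent ltr_pdivrMr// mul1r; lra.
have devV delta : 0 < delta <= 1 -> exists K T0, 0 <= K /\ forall T, (T0 <= T)%N ->
    exists N : set W, [/\ measurable N, (P N <= (K * T%:R `^ (- 1 - r / 2))%:E)%E &
      forall w, ~ N w -> `|V T w - limit_at mu1 mu2 (p T)| <= 8 * delta].
  move=> /andP[d0 d1].
  have e0 : 0 < delta / 24 by rewrite divr_gt0.
  have e01 : 0 < delta / 24 <= 1 by rewrite e0/=; lra.
  have [K K0 rateK] := rate r0 C0 e0 d0.
  have d20 : 0 <= 20 / delta by rewrite divr_ge0// ltW.
  have [n1 xn1] := powR_ge_eventually s0 d20.
  (* This bound on [T^(1-s)] serves twice: the spacing, at least half of it, exceeds [l0], so the
     rate of beta applies; and it is at least 2, as [threshold_le] requires. *)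
  have l20 : 0 <= 2 * l0.+1%:R :> R by rewrite mulr_ge0.
  have [n2 yn2] := powR_ge_eventually s1 l20.
  exists K, (maxn 1 (maxn n1 n2)); split=> // T; rewrite !geq_max => /and3P[T1 n1T n2T].
  have xT := xn1 T n1T; have yT := yn2 T n2T.
  have y2 : 2 <= T%:R `^ (1 - exponent r).
    by apply: le_trans yT; rewrite ler_peMr// ler1n.
  have l0q : (l0 <= spacing r T)%N.
    rewrite ltnW// -(ler_nat R); apply: le_trans (spacing_ge r0 T1).
    by rewrite ler_pdivlMr// mulrC.
  have mixT : mixing_bound P (Z T) T (spacing r T) (C * (spacing r T)%:R `^ (- 1 - r)).
    by apply: mixing_bound_array; exact: arrayC.
  have b0 : 0 <= C * (spacing r T)%:R `^ (- 1 - r) by rewrite mulr_ge0// powR_ge0.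
  have [N [mN PN VN]] := row_deviation sepA mixT b0 isT (isT : (0 < blocks r T)%N)
    (leq_blocks_spacing r T) e01 T1 (MleT T) d0 (threshold_le r0 T1 d0 y2 xT) (law1 T) (law2 T).
  exists N; split => //; apply: (le_trans PN); rewrite lee_fin; exact: rateK.
have r20 : 0 < r / 2 by rewrite divr_gt0.
(* The difference from [limit_at] at [p T] tends to 0 almost surely, and [limit_at] is continuous
   along [p T]. *)
have := ae_cvg0 r20 devV; apply: filterS => w V0.
rewrite V_limitE//.
have -> : (fun T => V_stat (fun i => Z T i w : A) (M T) T / T%:R) =
    (fun T => V T w - limit_at mu1 mu2 (p T) + limit_at mu1 mu2 (p T)).
  by apply/funext => T; rewrite subrK.
rewrite -[limit_at _ _ _]add0r; apply: cvgD => //; exact: cvg_limit_at.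
Qed.
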